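(* Let $d_v\ge 1$ and let $d_c = 3\cdot 2^i + 3$ for some integer $i \geq 1$. There exists $\eta > 0$ (depending on $d_c$) such that, with probability tending to $1$ as $n\to\infty$, the parity-check graph $B$ of a random $(d_v,d_c)$-LDPC code with block length $n$ has the following property: for every received vector $s\in\{0,1\}^n$, there is a solution to $\eta n$ rounds of the Lasserre hierarchy for the Nearest Codeword instance defined by $B$ and $s$ that satisfies every constraint and is $\frac{3}{d_c-3}$-biased; in particular its value $\frac1n\sum_v \|V_{\{v\}}(v\mapsto 1)\|^2$ equals $3/(d_c-3)$.
   Context: Random $(d_v,d_c)$-LDPC code: let $n$ be the block length and $m$ the number of checks, with $M := n d_v = m d_c$. Assign $d_v$ sockets to each of $n$ left (variable) vertices and $d_c$ sockets to each of $m$ right (check) vertices, numbering sockets $1,\dots,M$ on each side. Sample a uniformly random permutation $\pi$ of $\{1,\dots,M\}$ and join left socket $i$ to right socket $\pi(i)$. The parity-check graph $B=(L\cup R,E_B)$ has an edge between variable $i$ and check $j$ iff there is an odd number of socket edges between them. Nearest Codeword instance defined by $B$ ($|L|=n$) and $s\in\{0,1\}^n$: variables are the elements of $L$ with values in $\{0,1\}$; for each check $j$ with neighborhood $N(j)$, a constraint requiring $\sum_{v\in N(j)}x_v\equiv\sum_{v\in N(j)}s_v \pmod 2$. A $t$-local distribution on variables $V$ over alphabet $G$ is a collection $\{X_S(\alpha)\in[0,1]\}$, $S\subseteq V$, $|S|\le t$, $\alpha:S\to G$, with $X_\emptyset=1$ and $\sum_{\beta:T\setminus S\to G}X_T(\alpha\circ\beta)=X_S(\alpha)$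 for all $S\subseteq T$, $|T|\le t$. A solution to $t$ rounds of the Lasserre hierarchy is a family of real vectors $\{V_S(\alpha)\}_{|S|\le t,\alpha:S\to G}$ for which there is a $2t$-local distribution $\{X_S(\alpha)\}$ with $\langle V_S(\alpha),V_T(\beta)\rangle = X_{S\cup T}(\alpha\circ\beta)$ if $\alpha,\beta$ agree on $S\cap T$ and $=0$ otherwise. It satisfies a constraint with scope $(e_1,\dots,e_k)$ and predicate $P$ if $X_{\{e_1,\dots,e_k\}}(\alpha)=0$ whenever $(\alpha(e_1),\dots,\alpha(e_k))\notin P$; for $G=\{0,1\}$ it is $p$-biased if $X_{\{v\}}(v\mapsto1)=p$ for every $v$. *)

(* Defs.v *)
From HB Require Import structures.
From mathcomp Require Import all_boot all_order all_fingroup all_algebra.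
From mathcomp Require Import all_classical all_reals all_analysis.

Set Implicit Arguments.
Unset Strict Implicit.
Unset Printing Implicit Defensive.

Import Order.TTheory GRing.Theory Num.Theory.
Local Open Scope ring_scope.

(* A pair (S, alpha) with S a subset of V and alpha : S -> G is encoded as the
   finite function f : V -> option G that is Some (alpha v) on S and None
   elsewhere; S is recovered as pdom f. *)
Section PartialAssignments.
Variables V G : finType.

Definition passign := {ffun V -> option G}.

Implicit Types f g : passign.

Definition pdom f : {set V} := [set v | isSome (f v)]%SET.

Definition pempty : passign := [ffun=> None].

Definition psingle (v : V) (a : G) : passign :=
  [ffun u => if u == v then Some a else None].

Definition pextends g f : bool := [forall v in pdom f, g v == f v].

Definition pagree f g : bool := [forall v in pdom f :&: pdom g, f v == g v].

(* The assignment alpha o beta; used only when pagree f g. *)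
Definition pjoin f g : passign := [ffun v => if f v is Some a then Some a else g v].

End PartialAssignments.

(* The predicate is evaluated on the list of values of the scope variables, in
   the order in which the scope lists them. *)
Record constraint (V G : finType) := Constraint {
  cscope : seq V ;
  cpred : pred (seq G)
}.

Section Lasserre.
Variables (R : realType) (V G : finType).

(* Families are total functions on partial assignments; only their values on
   assignments with a domain of size at most t are meaningful. *)
Definition local_distribution (t : nat) (X : passign V G -> R) : Prop :=
  [/\ X (pempty V G) = 1,
      forall f, (#|pdom f| <= t)%N -> 0 <= X f <= 1
    & forall (f : passign V G) (T : {set V}),
        pdom f \subset T -> (#|T| <= t)%N ->
        \sum_(g : passign V G | (pdom g == T) && pextends g f) X g = X f].

Definition dotp (k : nat) (u v : 'rV[R]_k) : R := \sum_(j < k) u 0 j * v 0 j.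

Definition lasserre_solution (t k : nat) (W : passign V G -> 'rV[R]_k)
    (X : passign V G -> R) : Prop :=
  local_distribution (2 * t) X /\
  forall f g : passign V G, (#|pdom f| <= t)%N -> (#|pdom g| <= t)%N ->
    dotp (W f) (W g) = if pagree f g then X (pjoin f g) else 0.

(* The bound on the scope says that the t-local distribution X is defined on
   it, so that the values X f below are meaningful. *)
Definition satisfies (t : nat) (X : passign V G -> R) (c : constraint V G) : Prop :=
  (#|[set v in cscope c]%SET| <= t)%N /\
  forall f : passign V G, pdom f = [set v in cscope c]%SET ->
    ~~ cpred c (pmap f (cscope c)) -> X f = 0.

End Lasserre.

(* As in satisfies, the first conjunct says that X is defined on singletons. *)
Definition biased (R : realType) (V : finType) (t : nat) (p : R)
    (X : passign V bool -> R) : Prop :=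
  (1 <= t)%N /\ forall v : V, X (psingle v true) = p.

Definition lasserre_value (R : realType) (V : finType) (k : nat)
    (W : passign V bool -> 'rV[R]_k) : R :=
  (#|V|%:R)^-1 * \sum_(v : V) dotp (W (psingle v true)) (W (psingle v true)).

(* Bipartite graphs with left vertices L and right vertices C. *)
Definition bigraph (L C : finType) := L -> C -> bool.

Definition nbhd (L C : finType) (B : bigraph L C) (j : C) : {set L} :=
  [set v | B v j]%SET.

Definition nearest_codeword (L C : finType) (B : bigraph L C)
    (s : {ffun L -> bool}) (j : C) : constraint L bool :=
  {| cscope := enum (nbhd B j);
     cpred := fun xs : seq bool =>
       (\sum_(x <- xs) nat_of_bool x ==
        \sum_(v in nbhd B j) nat_of_bool (s v) %[mod 2])%N |}.

Definition num_checks (n dv dc : nat) : nat := (n * dv %/ dc)%N.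

(* Sockets are numbered from 0: left socket k belongs to variable k %/ dv, and
   right socket k to check k %/ dc. *)
Definition parity_graph (n dv dc : nat) (pi : 'S_(n * dv)) :
    bigraph 'I_n 'I_(num_checks n dv dc) :=
  fun v j => odd #|[set k : 'I_(n * dv) |
                     (k %/ dv == v)%N && (pi k %/ dc == j)%N]%SET|.

(* Probability, for pi uniform in 'S_(n * dv), that the parity-check graph has
   property E.  It is meaningful when dc divides n * dv. *)
Definition ldpc_prob (R : realType) (n dv dc : nat)
    (E : bigraph 'I_n 'I_(num_checks n dv dc) -> Prop) : R :=
  #|[set pi : 'S_(n * dv) | `[< E (@parity_graph n dv dc pi) >]]%SET|%:R
    / #|{: 'S_(n * dv)}|%:R.

(* Main.v *)
Require Import Defs.
From HB Require Import structures.
From mathcomp Require Import all_classical all_reals all_analysis.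
From mathcomp Require Import all_boot all_order all_fingroup all_algebra all_field.
From mathcomp Require Import ring lra zify.

(** With q = 2^i, replace the bits by hidden variables y_v in the field F_q and
    read x_v as the indicator of y_v = 0, which has bias 1/q = 3/(dc-3).  The
    parity of the number of zeros is constant on suitable cosets of linear codes
    whose dual distance is at least 3: on the projective line (length q+1, odd),
    on its shift by a conic (even), and on two affine lines with a common slope
    (length 2q, even).  Gluing these blocks gives both parities in the lengths
    dc = 3(q+1) and dc-2 = (q+1)+2q, the only check degrees that occur with high
    probability: a check sees a double edge at most once.

    Let E(u) be the sign forced on the character u by the dual codewords of a
    small set of checks that add up to u, and 0 if there is none.  With high
    probability every set of s <= rho n checks has at most s + s/4 collisions
    among its sockets, and then a sum of dual codewords from s checks has support
    at least max(2, s/2).  Hence E is well defined, multiplicative on characters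
    of small support, and vanishes on single variables; its Gram vectors,
    combined with the Fourier coefficients of the events x = f on S, are the
    Lasserre vectors. *)

Set Implicit Arguments.
Unset Strict Implicit.
Unset Printing Implicit Defensive.

Import Order.TTheory GRing.Theory Num.Theory.
Import numFieldNormedType.Exports.
Local Open Scope ring_scope.

(** * Finite functions and codes over a field of characteristic two *)

Section FiniteFunctions.
Variables (F : fieldType) (K : finType).
Implicit Types u v z : {ffun K -> F}.

Definition dotf u z : F := \sum_k u k * z k.

Definition fsupp u : {set K} := [set k | u k != 0]%SET.

Lemma dotfDl u v z : dotf (u + v) z = dotf u z + dotf v z.
Proof. by rewrite -big_split; apply: eq_bigr => k _; rewrite ffunE mulrDl. Qed.

Lemma dotfC u z : dotf u z = dotf z u.
Proof. by apply: eq_bigr => k _; rewrite mulrC. Qed.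

Lemma dotfDr u v z : dotf z (u + v) = dotf z u + dotf z v.
Proof. by rewrite dotfC dotfDl !(dotfC z). Qed.

Lemma dot0f z : dotf 0 z = 0.
Proof. by rewrite /dotf big1 // => k _; rewrite ffunE mul0r. Qed.

Lemma fsupp_eq0 u : (fsupp u == set0) = (u == 0).
Proof.
apply/eqP/eqP => [s0|->]; last by apply/setP => k; rewrite !inE ffunE eqxx.
apply/ffunP => k; rewrite ffunE; apply/eqP.
by have := in_set0 k; rewrite -s0 inE => /negbFE.
Qed.

Lemma fsuppD u v : fsupp (u + v) \subset fsupp u :|: fsupp v.
Proof.
apply/subsetP => k; rewrite !inE ffunE; apply: contraNT.
by rewrite negb_or !negbK => /andP[/eqP-> /eqP->]; rewrite addr0.
Qed.

Lemma card_fsuppD u v : (#|fsupp (u + v)%R| <= #|fsupp u| + #|fsupp v|)%N.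
Proof. by rewrite (leq_trans (subset_leq_card (fsuppD u v))) // cardsU leq_subr. Qed.

Definition fdelta (k : K) (a : F) : {ffun K -> F} :=
  [ffun l => if l == k then a else 0].

Lemma dotf_delta k a z : dotf (fdelta k a) z = a * z k.
Proof.
rewrite /dotf (bigD1 k) //= ffunE eqxx big1 ?addr0 // => l /negPf lk.
by rewrite ffunE lk mul0r.
Qed.

Lemma dotf_supp u z (S : {set K}) : fsupp u \subset S ->
  dotf u z = \sum_(k in S) u k * z k.
Proof.
move=> /subsetP uS; rewrite [RHS]big_mkcond; apply: eq_bigr => k _.
case: ifPn => // /(contra (uS k)); rewrite inE negbK => /eqP->.
by rewrite mul0r.
Qed.

End FiniteFunctions.

(** * Codes whose cosets fix the parity of the number of zeros *)

Section Codes.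
Variables (R : realFieldType) (F : finFieldType) (e : F -> R).
Hypothesis char2 : 2%N \in [pchar F].
Hypothesis eD : forall x y, e (x + y) = e x * e y.
Hypothesis e_sign : forall x, e x = 1 \/ e x = -1.
Hypothesis e_nontriv : exists x, e x = -1.

Lemma signE0 : e 0 = 1.
Proof.
have := eD 0 0; rewrite addr0.
by case: (e_sign 0) => -> //; rewrite mulN1r opprK.
Qed.

Lemma signM x : e x * e x = 1.
Proof. by case: (e_sign x) => ->; rewrite ?mulr1 // mulN1r opprK. Qed.

Lemma sign_nondeg x : (forall a, e (a * x) = 1) -> x = 0.
Proof.
move=> h; apply/eqP; apply/negPn/negP => x0; have [y ey] := e_nontriv.
have := h (y / x); rewrite mulfVK // ey => /eqP.
by rewrite eq_sym -subr_eq0 opprK -mulr2n pnatr_eq0.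
Qed.

Definition is0 (x : F) : nat := x == 0.
Arguments is0 x%_ring_scope.

(* H is the dual code, so the condition on y says that y + c is a codeword. *)
Definition parity_code (K : finType) (b : bool) : Prop :=
  exists (H : {set {ffun K -> F}}) (c : {ffun K -> F}),
  [/\ 0 \in H, {in H &, forall u v, u + v \in H},
      forall u, u \in H -> u != 0 -> (3 <= #|fsupp u|)%N
    & forall y, (forall u, u \in H -> e (dotf u (y + c)) = 1) ->
        odd (\sum_k is0 (y k))%N = b].

(** The dual code is a direct sum: a nonzero word has a nonzero component, which already has weight
    at least 3, and the zeros of the two blocks are counted separately. *)
Lemma parity_code_sum (K1 K2 : finType) b1 b2 :
  parity_code K1 b1 -> parity_code K2 b2 ->
  parity_code (K1 + K2)%type (b1 (+) b2).
Proof.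
move=> [H1 [c1 [z1 D1 d1 p1]]] [H2 [c2 [z2 D2 d2 p2]]].
pose l1 (u : {ffun K1 + K2 -> F}) : {ffun K1 -> F} := [ffun k => u (inl k)].
pose l2 (u : {ffun K1 + K2 -> F}) : {ffun K2 -> F} := [ffun k => u (inr k)].
pose join (u1 : {ffun K1 -> F}) (u2 : {ffun K2 -> F}) : {ffun K1 + K2 -> F} :=
  [ffun k => match k with inl k => u1 k | inr k => u2 k end].
have l1D u v : l1 (u + v) = l1 u + l1 v by apply/ffunP => k; rewrite !ffunE.
have l2D u v : l2 (u + v) = l2 u + l2 v by apply/ffunP => k; rewrite !ffunE.
have l10 : l1 0 = 0 by apply/ffunP => k; rewrite !ffunE.
have l20 : l2 0 = 0 by apply/ffunP => k; rewrite !ffunE.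
have lj1 u v : l1 (join u v) = u by apply/ffunP => k; rewrite !ffunE.
have lj2 u v : l2 (join u v) = v by apply/ffunP => k; rewrite !ffunE.
have dj u z : dotf u z = dotf (l1 u) (l1 z) + dotf (l2 u) (l2 z).
  rewrite /dotf big_sumType.
  by congr (_ + _); apply: eq_bigr => k _; rewrite !ffunE.
have s1 u : (#|fsupp (l1 u)| <= #|fsupp u|)%N.
  rewrite -(card_imset _ (@inl_inj K1 K2)); apply: subset_leq_card.
  by apply/subsetP => _ /imsetP[k + ->]; rewrite !inE ffunE.
have s2 u : (#|fsupp (l2 u)| <= #|fsupp u|)%N.
  rewrite -(card_imset _ (@inr_inj K1 K2)); apply: subset_leq_card.
  by apply/subsetP => _ /imsetP[k + ->]; rewrite !inE ffunE.
exists [set u | (l1 u \in H1) && (l2 u \in H2)]%SET, (join c1 c2); split.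
- by rewrite inE l10 l20 z1.
- move=> u v; rewrite !inE => /andP[u1 u2] /andP[v1 v2].
  by rewrite l1D l2D D1 ?D2.
- move=> u; rewrite inE => /andP[u1 u2] u0.
  have [e1|n1] := eqVneq (l1 u) 0; last exact: leq_trans (d1 _ u1 n1) (s1 u).
  have [e2|n2] := eqVneq (l2 u) 0; last exact: leq_trans (d2 _ u2 n2) (s2 u).
  case/eqP: u0; apply/ffunP => -[k|k]; rewrite ffunE.
    by move/ffunP: e1 => /(_ k); rewrite !ffunE.
  by move/ffunP: e2 => /(_ k); rewrite !ffunE.
- move=> y hy; rewrite big_sumType oddD; congr (_ (+) _).
    rewrite -(p1 (l1 y)).
      by congr odd; apply: eq_bigr => k _; rewrite ffunE.
    move=> u uH; have := hy (join u 0).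
    rewrite inE lj1 lj2 uH z2 => /(_ isT).
    by rewrite dj lj1 lj2 dot0f addr0 l1D lj1.
  rewrite -(p2 (l2 y)).
    by congr odd; apply: eq_bigr => k _; rewrite ffunE.
  move=> u uH; have := hy (join 0 u).
  rewrite inE lj1 lj2 uH z1 => /(_ isT).
  by rewrite dj lj1 lj2 dot0f add0r l2D lj2.
Qed.

Lemma parity_code_transport (K V : finType) (N : {set V}) b :
  parity_code K b -> #|N| = #|K| ->
  exists (H : {set {ffun V -> F}}) (c : {ffun V -> F}),
  [/\ 0 \in H /\ {in H &, forall u v, u + v \in H},
      forall u, u \in H -> fsupp u \subset N,
      forall u, u \in H -> u != 0 -> (3 <= #|fsupp u|)%N
    & forall y, (forall u, u \in H -> e (dotf u (y + c)) = 1) ->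
        odd (\sum_(v in N) is0 (y v))%N = b].
Proof.
move=> [H [c [H0 HD Hd Hp]]] NK.
pose f k : V := enum_val (cast_ord (esym NK) (enum_rank k)).
have f_inj : injective f.
  by move=> k l /enum_val_inj /cast_ord_inj /enum_rank_inj.
have fN : f @: K = N.
  apply/eqP; rewrite eqEcard card_imset // NK leqnn andbT.
  by apply/subsetP => _ /imsetP[k _ ->]; apply: enum_valP.
pose push (u : {ffun K -> F}) : {ffun V -> F} :=
  [ffun v => if [pick k | f k == v] is Some k then u k else 0].
pose pull (u : {ffun V -> F}) : {ffun K -> F} := [ffun k => u (f k)].
have pushK u : pull (push u) = u.
  apply/ffunP => k; rewrite !ffunE; case: pickP => [l /eqP/f_inj->//|/(_ k)].
  by rewrite eqxx.
have pushN u : fsupp (push u) \subset N.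
  apply/subsetP => v; rewrite inE ffunE -fN; case: pickP => [k /eqP<- _|].
    by rewrite imset_f.
  by rewrite eqxx.
have pullD u v : pull (u + v) = pull u + pull v.
  by apply/ffunP => k; rewrite !ffunE.
have dE u z : fsupp u \subset N -> dotf u z = dotf (pull u) (pull z).
  move=> /dotf_supp->; rewrite -fN big_imset /=; last by move=> ? ? _ _ /f_inj.
  by apply: eq_bigr => k _; rewrite !ffunE.
exists [set u | (fsupp u \subset N) && (pull u \in H)]%SET, (push c); split.
- split.
    rewrite inE; have -> : pull 0 = 0 by apply/ffunP => k; rewrite !ffunE.
    rewrite H0 andbT; have /eqP -> : fsupp (0 : {ffun V -> F}) == set0.
      by rewrite fsupp_eq0.
    exact: sub0set.
  move=> u v; rewrite !inE => /andP[uN uH] /andP[vN vH]; rewrite pullD HD // andbT.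
  by rewrite (subset_trans (fsuppD u v)) // subUset uN.
- by move=> u; rewrite inE => /andP[].
- move=> u; rewrite inE => /andP[uN uH] u0.
  have pu0 : pull u != 0.
    apply: contraNneq u0 => /ffunP pu; apply/eqP/ffunP => v; rewrite ffunE.
    apply/eqP; apply/negPn/negP => uv.
    have : v \in N by apply: (subsetP uN); rewrite inE.
    rewrite -fN => /imsetP[k _ vk].
    by have := pu k; rewrite !ffunE -vk => /eqP; apply/negP.
  apply: leq_trans (Hd _ uH pu0) _.
  rewrite -(card_imset _ f_inj); apply: subset_leq_card.
  by apply/subsetP => _ /imsetP[k + ->]; rewrite !inE ffunE.
- move=> y hy; rewrite -(Hp (pull y)).
    rewrite -fN big_imset /=; last by move=> ? ? _ _ /f_inj.
    by congr odd; apply: eq_bigr => k _; rewrite ffunE.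
  move=> u uH; have := hy (push u).
  rewrite inE pushN pushK uH => /(_ isT).
  by rewrite dE // pushK pullD pushK.
Qed.

(* The generator matrix of the code has the columns (p1 k, p2 k, p3 k), and the
   dual code consists of the linear relations among them. *)
Lemma columns_code (K : finType) (p1 p2 p3 c : {ffun K -> F}) b :
  (1 < #|K|)%N ->
  (forall k l x y, k != l -> x * p1 k + y * p1 l = 0 ->
     x * p2 k + y * p2 l = 0 -> x * p3 k + y * p3 l = 0 -> x = 0) ->
  (forall y, (forall u, dotf u p1 = 0 -> dotf u p2 = 0 -> dotf u p3 = 0 ->
       e (dotf u (y + c)) = 1) -> odd (\sum_k is0 (y k))%N = b) ->
  parity_code K b.
Proof.
move=> cK indep hb.
exists [set u | [&& dotf u p1 == 0, dotf u p2 == 0 & dotf u p3 == 0]]%SET, c; split.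
- by rewrite inE !dot0f eqxx.
- move=> u v; rewrite !inE !dotfDl.
  by move=> /and3P[/eqP-> /eqP-> /eqP->] /and3P[/eqP-> /eqP-> /eqP->]; rewrite addr0 eqxx.
- move=> u; rewrite inE => /and3P[/eqP u1 /eqP u2 /eqP u3] u0.
  rewrite ltnNge; apply/negP => su.
  have /set0Pn[k ku] : fsupp u != set0 by rewrite fsupp_eq0.
  (* A word of weight at most two sits on a pair of coordinates; for weight one the second
     coordinate is any other one, so [indep] covers both cases. *)
  have [l lk ukl] : exists2 l, l != k & fsupp u \subset [set k; l].
    have [s0|[l ul]] := set_0Vmem (fsupp u :\ k).
    - have : (0 < #|[set~ k]%SET|)%N by rewrite cardsC1 -ltnS prednK // ltnW.
      case/card_gt0P => l; rewrite !inE => lk; exists l => //.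
      by rewrite -(setD1K ku) s0 setU0 sub1set !inE eqxx.
    - exists l; first by move: ul; rewrite !inE => /andP[].
      move: su; rewrite (cardsD1 k) ku (cardsD1 l) ul !add1n !ltnS leqn0 cards_eq0.
      by move=> /eqP s0; rewrite -(setD1K ku) -(setD1K ul) s0 setU0.
  have H p : dotf u p = u k * p k + u l * p l.
    rewrite (dotf_supp _ ukl) big_setU1 ?big_set1 //.
    by rewrite inE eq_sym.
  move: u1 u2 u3; rewrite !H => h1 h2 h3.
  have := indep k l (u k) (u l); rewrite eq_sym => /(_ lk h1 h2 h3).
  by apply/eqP; move: ku; rewrite inE.
- move=> y hy; apply: hb => u h1 h2 h3; apply: hy.
  by rewrite inE h1 h2 h3 eqxx.
Qed.


Lemma sum_is0 (g : F -> F) (S : {set F}) :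
  (forall x, (g x == 0) = (x \in S)) -> (\sum_x is0 (g x))%N = #|S|.
Proof.
move=> gS; rewrite -sum1_card [RHS]big_mkcond; apply: eq_bigr => x _.
by rewrite /is0 gS; case: (x \in S).
Qed.

Lemma is0_const (a : F) : ~~ odd #|F| -> ~~ odd (\sum_(x : F) is0 a).
Proof. by move=> Fe; rewrite sum_nat_const oddM negb_and Fe. Qed.

Lemma sum_is0_affine (a b : F) : b != 0 -> (\sum_x is0 (a + x * b))%N = 1%N.
Proof.
move=> b0; rewrite (@sum_is0 _ [set - a / b]) ?cards1 // => x.
by rewrite inE addrC addr_eq0 -(inj_eq (mulIf (invr_neq0 b0))) mulfK.
Qed.

(** [line1] and [line2] are homogeneous coordinates on the projective line: [inr x] is the point (1,
    x), and [inl tt] is the point at infinity (0, 1). *)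
Definition line1 : {ffun unit + F -> F} := [ffun k => if k is inr x then 1 else 0].
Definition line2 : {ffun unit + F -> F} := [ffun k => if k is inr x then x else 1].

Lemma line_indep k l x y : k != l -> x * line1 k + y * line1 l = 0 ->
  x * line2 k + y * line2 l = 0 -> x = 0.
Proof.
rewrite !ffunE; case: k l => [[]|a] [[]|b] //; rewrite ?(mulr0, mulr1, add0r, addr0).
- by move=> _ -> /eqP; rewrite mul0r addr0 => /eqP.
- by [].
- move=> ab /eqP; rewrite addr_eq0 => /eqP->; rewrite mulNr addrC -mulrBr.
  move=> /eqP; rewrite mulf_eq0 subr_eq0.
  have [->|_ /= /eqP ba] := eqVneq y 0; first by rewrite oppr0.
  by case/eqP: ab; rewrite ba.
Qed.

(** The relation (1, x) = (1, 0) + x (0, 1) gives a dual word for every multiple [a], and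
    nondegeneracy of [e] turns the signs into an equation: [z] is affine, with its slope as value at
    infinity. *)
Lemma line_dual (z : {ffun unit + F -> F}) :
  (forall u, dotf u line1 = 0 -> dotf u line2 = 0 -> e (dotf u z) = 1) ->
  forall x, z (inr x) = z (inr 0) + x * z (inl tt).
Proof.
move=> h x; apply/eqP; rewrite -subr_eq0 GRing.subr_pchar2 //; apply/eqP.
apply: sign_nondeg => a.
rewrite -(h (fdelta (inr x) a + fdelta (inr 0) a + fdelta (inl tt) (a * x))).
- by rewrite !dotfDl !dotf_delta; congr e; ring.
- by rewrite !dotfDl !dotf_delta !ffunE mulr1 mulr0 addr0 addrr_pchar2.
- by rewrite !dotfDl !dotf_delta !ffunE mulr0 addr0 mulr1 addrr_pchar2.
Qed.

Lemma card_unitF : #|{: unit + F}| = #|F|.+1.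
Proof. by rewrite card_sum card_unit. Qed.

(** An affine function with nonzero slope has one zero, and none at infinity; a constant one has 0
    or [#|F|] zeros, an even number, besides the zero at infinity. *)
Lemma line_code_odd : ~~ odd #|F| -> parity_code (unit + F)%type true.
Proof.
move=> Fe; apply: (@columns_code _ line1 line2 0 0).
- by rewrite card_unitF ltnS; apply/card_gt0P; exists 0.
- by move=> k l x y kl h1 h2 _; apply: line_indep kl h1 h2.
move=> y hy; have zE := @line_dual y.
rewrite big_sumType (big_pred1 tt) /=; last by case.
rewrite (eq_bigr (fun x => is0 (y (inr 0) + x * y (inl tt)))); last first.
  move=> x _; congr is0; apply: zE => u u1 u2; rewrite -(hy u) ?addr0 //.
  by rewrite dotfC dot0f.
have [->|b0] := eqVneq (y (inl tt)) 0.
  under eq_bigr do rewrite mulr0 addr0.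
  by rewrite oddD (negPf (is0_const _ Fe)) /is0 eqxx.
by rewrite sum_is0_affine // /is0 (negPf b0).
Qed.

(* Adding x^2 to an affine function turns the points of a conic together with
   its nucleus into a hyperoval, which every line meets in zero or two points. *)
Lemma line_code_even : ~~ odd #|F| -> parity_code (unit + F)%type false.
Proof.
move=> Fe; pose sq : {ffun unit + F -> F} := [ffun k => if k is inr x then x ^+ 2 else 0].
apply: (@columns_code _ line1 line2 0 sq).
- by rewrite card_unitF ltnS; apply/card_gt0P; exists 0.
- by move=> k l x y kl h1 h2 _; apply: line_indep kl h1 h2.
move=> y hy; have zE := @line_dual (y + sq).
rewrite big_sumType (big_pred1 tt) /=; last by case.
set a := y (inr 0); set b := y (inl tt).
have {zE}yE x : y (inr x) = a + x * b + x ^+ 2.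
  have := zE _ x; rewrite !ffunE expr0n /= !addr0 -/a -/b => <-.
    by rewrite -addrA addrr_pchar2 ?addr0.
  by move=> u u1 u2; rewrite -(hy u) // dotfC dot0f.
have sqr_eq u v : (u ^+ 2 == v ^+ 2 :> F) = (u == v).
  rewrite -subr_eq0 subr_sqr mulf_eq0 subr_eq0 -(GRing.subr_pchar2 char2) subr_eq0.
  by rewrite orbb.
rewrite (eq_bigr (fun x => is0 (a + x * b + x ^+ 2))); last first.
  by move=> x _; rewrite yE.
(* With slope zero the point at infinity is a zero, and exactly one more exists because squaring is
   bijective. *)
have [b0|b0] := eqVneq b 0.
  have /fin_all_exists[r rE] : forall c : F, exists r, r ^+ 2 = c.
    have inj : injective (fun x : F => x ^+ 2).
      by move=> x x' /eqP; rewrite sqr_eq => /eqP.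
    by move=> c; have [g _ gK] := injF_bij inj; exists (g c).
  rewrite (@sum_is0 _ [set r a]) ?cards1 ?b0 /is0 ?eqxx // => x.
  rewrite mulr0 addr0 -(GRing.subr_pchar2 char2) subr_eq0 inE.
  by rewrite -{1}(rE a) sqr_eq eq_sym.
rewrite /is0 (negPf b0) add0n -/(is0 _).
(* With nonzero slope infinity is not a zero, and a root [x] has exactly one companion, [x + b]. *)
have [/existsP[x /eqP xE]|/existsPn none] :=
  boolP [exists x, a + x * b + x ^+ 2 == 0].
  rewrite (@sum_is0 _ [set x; x + b]); last first.
    move=> t; have -> : a + t * b + t ^+ 2 = (t - x) * (t - (x + b)).
      have -> : a = - (x * b + x ^+ 2) by apply/eqP; rewrite -addr_eq0 addrA xE.
      have d2 (u : F) : u *+ 2 = 0 by rewrite mulr2n addrr_pchar2.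
      (* [ring] does not use the characteristic, so a double, which vanishes, is subtracted
         first. *)
      rewrite -[LHS](subr0) -[in LHS](d2 (t * b + t * x - x * b - x ^+ 2)).
      by ring.
    by rewrite mulf_eq0 !subr_eq0 !inE.
  by rewrite cards2 -{1}[x]addr0 (inj_eq (addrI x)) eq_sym b0.
by rewrite (@sum_is0 _ set0) ?cards0 // => x; rewrite inE; apply/negbTE.
Qed.

(** The columns (1, 0, x) and (0, 1, x) generate the pairs of affine functions with a common slope,
    one function for each boolean. *)
Definition affine1 : {ffun bool * F -> F} := [ffun k : bool * F => if k.1 then 1 else 0].
Definition affine2 : {ffun bool * F -> F} := [ffun k : bool * F => if k.1 then 0 else 1].
Definition affine3 : {ffun bool * F -> F} := [ffun k : bool * F => k.2].

(** A nonzero common slope gives one zero on each of the two lines; slope zero gives 0 or [#|F|]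
    zeros on each. Both totals are even. *)
Lemma affine_code_even : ~~ odd #|F| -> parity_code (bool * F)%type false.
Proof.
move=> Fe; apply: (@columns_code _ affine1 affine2 affine3 0).
- rewrite card_prod card_bool; have : (0 < #|F|)%N by apply/card_gt0P; exists 0.
  by case: #|F| => [|[]].
- move=> [k a] [l b] x y kl; rewrite !ffunE /=.
  case: k l kl => -[]; rewrite ?(mulr0, mulr1, addr0, add0r) // => ab.
    move=> /eqP; rewrite addr_eq0 => /eqP-> _.
    rewrite mulNr addrC -mulrBr => /eqP; rewrite mulf_eq0 subr_eq0.
    have [->|_ /= /eqP ba] := eqVneq y 0; first by rewrite oppr0.
    by case/eqP: ab; rewrite ba.
  move=> _ /eqP; rewrite addr_eq0 => /eqP->.
  rewrite mulNr addrC -mulrBr => /eqP; rewrite mulf_eq0 subr_eq0.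
  have [->|_ /= /eqP ba] := eqVneq y 0; first by rewrite oppr0.
  by case/eqP: ab; rewrite ba.
move=> y hy; pose d := y (true, 1) + y (true, 0).
have yE k x : y (k, x) = y (k, 0) + x * d.
  apply/eqP; rewrite -subr_eq0 GRing.subr_pchar2 //; apply/eqP.
  apply: sign_nondeg => a.
  rewrite -(hy (fdelta (k, x) a + fdelta (k, 0) a +
                (fdelta (true, 1) (a * x) + fdelta (true, 0) (a * x)))).
  - by rewrite addr0 !dotfDl !dotf_delta /d; congr e; ring.
  - by rewrite !dotfDl !dotf_delta !ffunE /= !addrr_pchar2 ?addr0.
  - by rewrite !dotfDl !dotf_delta !ffunE /= !addrr_pchar2 ?addr0.
  - by rewrite !dotfDl !dotf_delta !ffunE /= !mulr0 mulr1 !addr0 addrr_pchar2.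
have -> : (\sum_k is0 (y k) = \sum_k \sum_x is0 (y (k, x)))%N.
  by rewrite pair_bigA; apply: eq_bigr => -[].
rewrite big_bool /=.
have E k : (\sum_x is0 (y (k, x)) = \sum_x is0 (y (k, 0%R) + x * d))%N.
  by apply: eq_bigr => x _; rewrite yE.
rewrite !E; have [->|d0] := eqVneq d 0; last by rewrite !sum_is0_affine.
have Z k : ~~ odd (\sum_x is0 (y (k, 0%R) + x * 0)).
  by under eq_bigr do rewrite mulr0 addr0; apply: is0_const.
by rewrite oddD !(negPf (Z _)).
Qed.

End Codes.

(** The character is the sign of one coordinate of the field over its prime field, chosen not to
    vanish at 1. *)
Lemma sign_character_exists (R : realFieldType) (F : finFieldType) : 2%N \in [pchar F] ->
  exists e : F -> R, [/\ forall x y, e (x + y) = e x * e y,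
    forall x, e x = 1 \/ e x = -1 & exists x, e x = -1].
Proof.
move=> char2; pose V := pPrimeCharType char2.
have /existsP[i i1] : [exists i, coord (vbasis fullv) i (1 : V) != 0].
  apply: contraT => /existsPn c0; rewrite -(oner_eq0 V); apply/eqP.
  rewrite (coord_vbasis (memvf (1 : V))) big1 // => i _.
  by have := c0 i; rewrite negbK => /eqP->; rewrite scale0r.
pose l x := coord (vbasis fullv) i (x : V).
have lD x y : l (x + y) = l x + l y by apply: linearD.
pose g (a : 'F_2) : R := (-1) ^+ (a : nat).
have gD a b : g (a + b) = g a * g b.
  by rewrite /g -exprD -[RHS]signr_odd -modn2.
have g_sign a : g a = 1 \/ g a = -1.
  by rewrite /g -signr_odd; case: odd; [right|left].
exists (g \o l); split => [x y|x|] /=; rewrite ?lD //.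
exists 1; move: i1; rewrite -/(l 1); case: (l 1) => -[|[|m]] //= lt _.
Qed.

(** * Fourier analysis and pseudo-expectations *)

Section Fourier.
Variables (R : realFieldType) (F : finFieldType) (e : F -> R).
Hypothesis char2 : 2%N \in [pchar F].
Hypothesis eD : forall x y, e (x + y) = e x * e y.
Hypothesis e_sign : forall x, e x = 1 \/ e x = -1.
Hypothesis e_nontriv : exists x, e x = -1.
Variable V : finType.
Local Notation Omega := {ffun V -> F}.
Implicit Types (f g : Omega -> R) (u v y z : Omega) (S : {set V}).

Lemma addff u : u + u = 0.
Proof. by apply/ffunP => k; rewrite !ffunE addrr_pchar2. Qed.

Lemma addKff u v : v + u + u = v.
Proof. by rewrite -addrA addff addr0. Qed.

Lemma addff_inj u : injective (fun v => v + u).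
Proof. exact: addIr. Qed.

Definition chi u y : R := e (dotf u y).

Lemma chiD u v y : chi (u + v) y = chi u y * chi v y.
Proof. by rewrite /chi dotfDl eD. Qed.

Lemma chiDr u y z : chi u (y + z) = chi u y * chi u z.
Proof. by rewrite /chi dotfDr eD. Qed.

Lemma chi0 y : chi 0 y = 1.
Proof. by rewrite /chi dot0f (signE0 eD e_sign). Qed.

Lemma chiC u y : chi u y = chi y u. Proof. by rewrite /chi dotfC. Qed.

Lemma neg1_eq0 (x : R) : x = - x -> x = 0.
Proof. by move=> /eqP; rewrite -subr_eq0 opprK -mulr2n mulrn_eq0 => /eqP. Qed.

(** Translation by an element of sign -1 permutes the group and negates the sum. *)
Lemma sum_group_sign (H : {set Omega}) z : {in H &, forall u v, u + v \in H} ->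
  (exists2 u, u \in H & chi u z != 1) -> \sum_(u in H) chi u z = 0.
Proof.
move=> HD [u uH uz]; apply: neg1_eq0.
rewrite [LHS](reindex_inj (@addff_inj u)) /= -sumrN; apply: eq_big => [v|v _].
  apply/idP/idP => vH; last exact: HD.
  by rewrite -[v](addKff u) HD.
rewrite chiD; have : chi u z = -1.
  by move: uz; rewrite /chi; case: (e_sign (dotf u z)) => ->; rewrite ?eqxx.
by move=> ->; rewrite mulrN1.
Qed.

Lemma sum_chi z : \sum_u chi u z = if z == 0 then #|{: Omega}|%:R else 0.
Proof.
case: eqP => [->|/eqP z0].
  under eq_bigr do rewrite chiC chi0.
  by rewrite sumr_const.
rewrite (eq_bigl [in [set: Omega]%SET]); last by move=> u; rewrite inE.
apply: sum_group_sign => [u v|]; first by rewrite !inE.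
move: z0; rewrite -fsupp_eq0 => /set0Pn[k]; rewrite inE => zk.
have [a ea] := e_nontriv; exists (fdelta k (a / z k)); first by rewrite inE.
rewrite /chi dotf_delta mulfVK // ea -subr_eq0 -opprD oppr_eq0.
by rewrite -mulr2n mulrn_eq0 oner_eq0.
Qed.

Lemma card_ffun_neq0 : #|{: Omega}|%:R != 0 :> R.
Proof. by rewrite pnatr_eq0 -lt0n; apply/card_gt0P; exists 0. Qed.

Definition hat f u : R := #|{: Omega}|%:R^-1 * \sum_y f y * chi u y.

(** After expansion, orthogonality of the characters in [v] leaves only the diagonal terms
    [z = y]. *)
Lemma hat_conv f g u :
  \sum_v hat f v * hat g (v + u) = hat (fun y => f y * g y) u.
Proof.
set N := #|{: Omega}|%:R : R; have N0 : N != 0 := card_ffun_neq0.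
transitivity (N^-1 * N^-1 *
    \sum_y \sum_z f y * g z * chi u z * \sum_v chi v (y + z)).
  rewrite mulr_sumr; under [RHS]eq_bigr do rewrite mulr_sumr.
  rewrite (eq_bigr (fun v => \sum_y \sum_z
     N^-1 * N^-1 * (f y * g z * chi u z * chi v (y + z)))).
    rewrite exchange_big; apply: eq_bigr => y _ /=.
    rewrite exchange_big; apply: eq_bigr => z _ /=.
    by rewrite -mulr_sumr -mulr_sumr.
  move=> v _; rewrite /hat mulrACA mulr_suml mulr_sumr.
  apply: eq_bigr => y _; rewrite !mulr_sumr; apply: eq_bigr => z _.
  by rewrite chiD chiDr /=; ring.
rewrite /hat -/N mulr_sumr mulr_sumr; apply: eq_bigr => y _.
rewrite (bigD1 y) //= [X in _ + X]big1 ?addr0 => [|z zy]; last first.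
  rewrite sum_chi ifF ?mulr0 //; apply: contraNF zy => /eqP yz.
  by rewrite -[z](addKff y) [z + y]addrC yz add0r.
rewrite addff sum_chi eqxx -/N; move: N0; clearbody N => N0.
by field.
Qed.

Definition depends_on S f : Prop :=
  forall y z, (forall k, k \in S -> y k = z k) -> f y = f z.

(** Shifting [y] at a coordinate of [u] outside [S] leaves [f] alone and can be chosen to flip
    [chi u]. *)
Lemma hat_supp S f u : depends_on S f -> ~~ (fsupp u \subset S) -> hat f u = 0.
Proof.
move=> fS /subsetPn[v]; rewrite inE => uv vS.
suff sum0 : \sum_y f y * chi u y = 0 by rewrite /hat sum0 mulr0.
have [a ea] := e_nontriv; set d := fdelta v (a / u v).
have ud : chi u d = -1 by rewrite chiC /chi dotf_delta mulfVK.
apply: neg1_eq0; rewrite [LHS](reindex_inj (@addff_inj d)) /= -sumrN.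
apply: eq_bigr => y _; rewrite chiDr ud mulrN1 mulrN; congr (- (_ * _)).
apply: fS => w wS; rewrite !ffunE; case: eqP => [wv|]; last by rewrite addr0.
by rewrite wv (negPf vS) in wS.
Qed.

Lemma hat_chi f u v : hat (fun y => chi u y * f y) v = hat f (u + v).
Proof.
by congr (_ * _); apply: eq_bigr => y _; rewrite chiD; ring.
Qed.

Section Moments.
Variables (E : Omega -> R) (D : nat).
Hypothesis E0 : E 0 = 1.
Hypothesis EM : forall u v, (#|fsupp u| <= D)%N -> (#|fsupp v| <= D)%N ->
  E v != 0 -> E (u + v) = E u * E v.

(** The linear functional that sends the character [chi u] to [E u]: a pseudo-expectation with the
    prescribed moments. *)
Definition pexp f : R := \sum_u hat f u * E u.

Lemma eq_pexp f g : f =1 g -> pexp f = pexp g.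
Proof.
move=> fg; apply: eq_bigr => u _; congr (_ * _ * _).
by apply: eq_bigr => y _; rewrite fg.
Qed.

Lemma pexp0 : pexp (fun=> 0) = 0.
Proof.
rewrite /pexp big1 // => u _; rewrite /hat big1 ?mulr0 ?mul0r // => y _.
by rewrite mul0r.
Qed.

Lemma pexp_sum (I : Type) (r : seq I) (P : pred I) (f : I -> Omega -> R) :
  pexp (fun y => \sum_(i <- r | P i) f i y) = \sum_(i <- r | P i) pexp (f i).
Proof.
rewrite /pexp [RHS]exchange_big; apply: eq_bigr => u _ /=.
rewrite -mulr_suml; congr (_ * _); rewrite /hat -mulr_sumr; congr (_ * _).
by rewrite [RHS]exchange_big; apply: eq_bigr => y _; rewrite mulr_suml.
Qed.

Lemma pexpZ a f : pexp (fun y => a * f y) = a * pexp f.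
Proof.
rewrite /pexp mulr_sumr; apply: eq_bigr => u _; rewrite mulrA; congr (_ * _).
rewrite /hat mulrCA; congr (_ * _); rewrite mulr_sumr.
by apply: eq_bigr => y _; rewrite mulrA.
Qed.

Lemma hat1 u : hat (fun=> 1) u = (u == 0)%:R.
Proof.
rewrite /hat; under eq_bigr do rewrite mul1r chiC.
rewrite sum_chi; case: eqP => _; last by rewrite mulr0.
by rewrite mulVf ?card_ffun_neq0.
Qed.

Lemma pexp1 : pexp (fun=> 1) = 1.
Proof.
rewrite /pexp (bigD1 (0 : Omega)) //= big1 => [|u u0]; rewrite hat1.
  by rewrite eqxx E0 mulr1 addr0.
by rewrite (negPf u0) mul0r.
Qed.

(** * Gram vectors for the moments *)

Section Vectors.
Variable T : nat.
Hypothesis TD : (2 * T <= D)%N.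

Definition small u := (#|fsupp u| <= T)%N.

(* The canonical member of the class of u for the relation E (u + v) != 0. *)
Definition class_repr u : Omega := odflt u [pick v | small v && (E (u + v) != 0)].

Lemma smallD u v : small u -> small v -> (#|fsupp (u + v)%R| <= D)%N.
Proof.
move=> uT vT; apply: leq_trans (card_fsuppD u v) _; apply: leq_trans TD.
by rewrite mul2n -addnn leq_add.
Qed.

Lemma class_reprP u : small u -> small (class_repr u) /\ E (u + class_repr u) != 0.
Proof.
move=> uT; rewrite /class_repr; case: pickP => [v /andP[]//|/(_ u)].
by rewrite uT addff E0 oner_eq0.
Qed.

Definition gvec u v : R := if v == class_repr u then E (u + v) else 0.

(** If the representatives agree, multiplicativity merges the two factors into [E (u + v)]. If they
    differ, [E (u + v)] must vanish: otherwise [u] and [v] would be related to the same small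
    vectors, and the pick would be the same. *)
Lemma gvec_dot u v : small u -> small v -> \sum_w gvec u w * gvec v w = E (u + v).
Proof.
move=> uT vT; have [ruT ru] := class_reprP uT; have [rvT rv] := class_reprP vT.
have addE (a b w : Omega) : (a + b) + (b + w) = a + w by rewrite addrA addKff.
rewrite (bigD1 (class_repr u)) //= big1 ?addr0 => [|w wu]; last first.
  by rewrite /gvec (negPf wu) mul0r.
rewrite /gvec eqxx; case: eqP => [ruv|ruv].
  rewrite -EM ?smallD //; last by rewrite ruv.
  by rewrite [v + _]addrC addE.
rewrite mulr0; apply/esym/eqP; apply/negPn/negP => uv; apply: ruv.
have same w : small w -> E (u + w) = E (v + w) * E (u + v).
  move=> wT; rewrite -EM ?smallD //; congr E.
  by rewrite [RHS]addrC addE.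
have e1 w : small w && (E (u + w) != 0) = small w && (E (v + w) != 0).
  by case wT : (small w) => //=; rewrite same // mulf_eq0 negb_or uv andbT.
rewrite /class_repr (eq_pick e1); case: pickP => [//|/(_ v)].
by rewrite vT addff E0 oner_eq0.
Qed.

Definition lvec f : 'rV[R]_#|{: Omega}| :=
  \row_j \sum_u hat f u * gvec u (enum_val j).

(** Only characters supported in [S1] and [S2] have nonzero coefficients, and these are small enough
    for [gvec_dot]; collecting the terms by [u + v] gives the convolution of [hat_conv]. *)
Lemma lvec_dot f g S1 S2 : depends_on S1 f -> depends_on S2 g ->
  (#|S1| <= T)%N -> (#|S2| <= T)%N ->
  \sum_j lvec f 0 j * lvec g 0 j = pexp (fun y => f y * g y).
Proof.
move=> fS gS S1T S2T.
have sm h S u : depends_on S h -> (#|S| <= T)%N -> small u \/ hat h u = 0.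
  move=> hS ST; have [uS|uS] := boolP (fsupp u \subset S).
    by left; apply: leq_trans (subset_leq_card uS) ST.
  by right; apply: hat_supp hS uS.
transitivity (\sum_w (\sum_u hat f u * gvec u w) * (\sum_v hat g v * gvec v w)).
  rewrite [RHS](reindex_onto (@enum_val _ Omega) enum_rank) /=; last first.
    by move=> w _; rewrite enum_rankK.
  by apply: eq_big => [j|j _]; rewrite ?enum_valK ?eqxx // !mxE.
transitivity (\sum_u \sum_v hat f u * hat g v * E (u + v)).
  rewrite (eq_bigr (fun w => \sum_u \sum_v
     hat f u * hat g v * (gvec u w * gvec v w))); last first.
    move=> w _; rewrite mulr_suml; apply: eq_bigr => u _.
    by rewrite mulr_sumr; apply: eq_bigr => v _; ring.
  rewrite exchange_big; apply: eq_bigr => u _; rewrite exchange_big.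
  apply: eq_bigr => v _; rewrite -mulr_sumr.
  case: (sm f S1 u) => // [uT|->]; last by rewrite !mul0r.
  case: (sm g S2 v) => // [vT|->]; last by rewrite mulr0 !mul0r.
  by rewrite gvec_dot.
rewrite /pexp; under [RHS]eq_bigr => w _ do rewrite -hat_conv mulr_suml.
rewrite [RHS]exchange_big; apply: eq_bigr => u _ /=.
rewrite [LHS](reindex_inj (@addrI _ u)); apply: eq_bigr => w _ /=.
by rewrite addrA addff add0r.
Qed.

Lemma pexp_sqr_ge0 f S : depends_on S f -> (#|S| <= T)%N ->
  0 <= pexp (fun y => f y * f y).
Proof.
move=> fS ST; rewrite -(lvec_dot fS fS) //; apply: sumr_ge0 => j _.
by rewrite -expr2 sqr_ge0.
Qed.

End Vectors.

(** Multiplication by [chi u] translates the coefficients by [u], and [EM] pulls [E u] out of each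
    term. *)
Lemma pexp_chi f S u : depends_on S f -> (#|S| <= D)%N -> (#|fsupp u| <= D)%N ->
  E u != 0 -> pexp (fun y => chi u y * f y) = E u * pexp f.
Proof.
move=> fS SD uD u0; rewrite /pexp mulr_sumr.
rewrite [LHS](reindex_inj (@addff_inj u)); apply: eq_bigr => v _ /=.
rewrite hat_chi [u + _]addrC addKff.
have [vS|vS] := boolP (fsupp v \subset S); last first.
  by rewrite (hat_supp fS) // !mul0r mulr0.
by rewrite EM // ?(leq_trans (subset_leq_card vS)) //; ring.
Qed.

(** By [pexp_chi], multiplying [f] by the sum of [E u * chi u] over [H] multiplies its
    pseudo-expectation by [#|H|]. Pointwise this sum is that of the signs [chi u (y + c)], which
    cancel wherever [f] is nonzero. *)
Lemma pexp_eq0 f S (H : {set Omega}) c : depends_on S f -> (#|S| <= D)%N ->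
  0 \in H -> {in H &, forall u v, u + v \in H} ->
  (forall u, u \in H -> (#|fsupp u| <= D)%N /\ E u = chi u c) ->
  (forall y, f y != 0 -> exists2 u, u \in H & chi u (y + c) != 1) ->
  pexp f = 0.
Proof.
move=> fS SD H0 HD HE hf.
have chi2 u y : chi u y * chi u y = 1 by rewrite /chi (signM e_sign).
have chin0 u y : chi u y != 0.
  by apply/eqP => /(congr1 (fun x => x * chi u y)); rewrite chi2 mul0r => /eqP; rewrite oner_eq0.
have : #|H|%:R * pexp f = 0.
  transitivity (pexp (fun y => \sum_(u in H) E u * (chi u y * f y))).
    rewrite pexp_sum mulr_natl -sumr_const; apply: eq_bigr => u uH.
    have [uD Eu] := HE u uH.
    by rewrite pexpZ (pexp_chi fS) // Eu // mulrA chi2 mul1r.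
  rewrite -[RHS]pexp0; apply: eq_pexp => y.
  rewrite (eq_bigr (fun u => chi u (y + c) * f y)); last first.
    by move=> u uH; have [_ ->] := HE u uH; rewrite chiDr; ring.
  rewrite -mulr_suml; have [->|fy] := eqVneq (f y) 0; first by rewrite mulr0.
  by rewrite sum_group_sign ?mul0r //; apply: hf.
move/eqP; rewrite mulf_eq0 pnatr_eq0 cards_eq0 => /orP[/eqP H00|/eqP//].
by rewrite H00 inE in H0.
Qed.

Lemma pexp_singleton f (k : V) : depends_on [set k]%SET f ->
  (forall u, (#|fsupp u| <= 1)%N -> u != 0 -> E u = 0) -> pexp f = hat f 0.
Proof.
move=> fv E1; rewrite /pexp (bigD1 (0 : Omega)) //= E0 mulr1 big1 ?addr0 // => u u0.
have [uv|uv] := boolP (fsupp u \subset [set k]%SET).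
  by rewrite E1 ?mulr0 //; have := subset_leq_card uv; rewrite cards1.
by rewrite (hat_supp fv) // mul0r.
Qed.

End Moments.

(** Translations at the coordinate [v] show that its values are equally frequent. *)
Lemma hat0_point (v : V) : hat (fun y => (y v == 0)%:R) 0 = #|F|%:R^-1.
Proof.
rewrite /hat; under eq_bigr do rewrite chi0 mulr1.
have : #|{: Omega}|%:R = #|F|%:R * \sum_(y : Omega) (y v == 0)%:R :> R.
  transitivity (\sum_(y : Omega) \sum_a (y v == a)%:R : R).
    rewrite -sumr_const; apply: eq_bigr => y _.
    rewrite (bigD1 (y v)) //= eqxx big1 ?addr0 // => a.
    by rewrite eq_sym => /negPf->.
  rewrite exchange_big mulr_natl -sumr_const; apply: eq_bigr => a _ /=.
  rewrite [LHS](reindex_inj (@addff_inj (fdelta v a))); apply: eq_bigr => y _ /=.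
  by rewrite !ffunE eqxx -subr_eq0 addrK.
move: card_ffun_neq0; set N := _%:R; set s := \sum_y _ => N0 NE.
rewrite NE in N0; rewrite NE; move: N0; rewrite mulf_eq0 negb_or => /andP[q0 s0].
by rewrite invfM mulfVK.
Qed.

End Fourier.

(** * Lasserre solutions from moments *)

Section ZeroPatterns.
Variables (R : realType) (F : finFieldType) (V : finType).
Local Notation Omega := {ffun V -> F}.
Implicit Types (f g : passign V bool) (y : Omega).

Definition consistent f y : bool :=
  [forall v, if f v is Some a then (y v == 0) == a else true].

Definition ind f y : R := (consistent f y)%:R.

Lemma consistentP f y :
  reflect (forall v a, f v = Some a -> (y v == 0) = a) (consistent f y).
Proof.
apply: (iffP forallP) => h v; last by case fv: (f v) => [a|//]; rewrite (h v a).
by move=> a fv; have := h v; rewrite fv => /eqP.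
Qed.

Lemma mem_pdom f v : (v \in pdom f) = isSome (f v).
Proof. by rewrite inE. Qed.

Lemma ind_depends f : depends_on (pdom f) (ind f).
Proof.
move=> y z yz; rewrite /ind; congr (_%:R : R); congr nat_of_bool.
apply: eq_forallb => v; case fv: (f v) => [a|//].
by rewrite yz // mem_pdom fv.
Qed.

Lemma ind_sqr f y : ind f y * ind f y = ind f y.
Proof. by rewrite /ind -natrM mulnb andbb. Qed.

Lemma ind_join f g y : ind f y * ind g y =
  if pagree f g then ind (pjoin f g) y else 0.
Proof.
rewrite /ind -natrM mulnb; case: ifP => fg.
  congr (_%:R); congr nat_of_bool; apply/andP/consistentP => [[]|h].
    move=> /consistentP hf /consistentP hg v a; rewrite ffunE.
    by case fv: (f v) => [b|]; [case=> <-; apply: hf | apply: hg].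
  split; apply/consistentP => v a va.
    by apply: h; rewrite ffunE va.
  case fv: (f v) => [b|]; last by apply: h; rewrite ffunE fv.
  have bv := h v b; rewrite ffunE fv in bv; rewrite bv //.
  have /forallP/(_ v) := fg.
  by rewrite inE !mem_pdom fv va /= => /eqP[].
case: andP => // -[/consistentP hf /consistentP hg].
case/negP: fg; apply/forallP => v; apply/implyP; rewrite inE !mem_pdom.
case fv: (f v) => [a|//]; case gv: (g v) => [b|//] _.
by rewrite -(hf _ _ fv) (hg _ _ gv).
Qed.

(** Exactly one pattern on [S] is consistent with [y], the one read off [y]; it extends [f] exactly
    when [f] is consistent with [y]. *)
Lemma ind_extends f (S : {set V}) y : pdom f \subset S ->
  \sum_(g : passign V bool | (pdom g == S) && pextends g f) ind g y = ind f y.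
Proof.
move=> fS; pose g0 : passign V bool :=
  [ffun v => if v \in S then Some (y v == 0) else None].
have g0S : pdom g0 = S.
  by apply/setP => v; rewrite mem_pdom ffunE; case: (v \in S).
have cg0 : consistent g0 y.
  by apply/consistentP => v a; rewrite ffunE; case: ifP => // _ [].
have ext : pextends g0 f = consistent f y.
  apply/forallP/consistentP => [h v a fv|h v].
    have := h v; rewrite mem_pdom fv ffunE /= => /eqP.
    by case: ifP => // _ [].
  apply/implyP => vf; rewrite ffunE (subsetP fS _ vf).
  by move: vf; rewrite mem_pdom; case fv: (f v) => [a|//] _; rewrite (h _ _ fv).
have uniq g : pdom g = S -> consistent g y -> g = g0.
  move=> gS /consistentP h; apply/ffunP => v; rewrite ffunE -gS mem_pdom.
  by case gv: (g v) => [a|//] /=; rewrite (h _ _ gv).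
rewrite (bigID (pred1 g0)) /= [X in _ + X]big1 ?addr0; last first.
  move=> g /andP[/andP[/eqP gS _] gg0]; rewrite /ind.
  by case: (boolP (consistent g y)) => // /(uniq _ gS)/eqP; rewrite (negPf gg0).
rewrite big_mkcond (bigD1 g0) //= big1 ?addr0; last by move=> g /negPf->; rewrite andbF.
by rewrite g0S !eqxx ext /ind cg0 andbT; case: (consistent f y).
Qed.

Lemma sum_pmap f y : consistent f y ->
  (\sum_(x <- pmap f (enum (pdom f))) nat_of_bool x = \sum_(v in pdom f) is0 (y v))%N.
Proof.
move=> /consistentP h; rewrite big_pmap big_enum_cond.
apply: eq_big => [v|v]; rewrite ?andbT // mem_pdom.
by case fv: (f v) => [a|//] _; rewrite /is0 (h _ _ fv).
Qed.

End ZeroPatterns.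

Section FromMoments.
Variables (R : realType) (F : finFieldType) (e : F -> R).
Hypothesis char2 : 2%N \in [pchar F].
Hypothesis eD : forall x y, e (x + y) = e x * e y.
Hypothesis e_sign : forall x, e x = 1 \/ e x = -1.
Hypothesis e_nontriv : exists x, e x = -1.
Variable V : finType.
Local Notation Omega := {ffun V -> F}.
Variables (E : Omega -> R) (t : nat).
Hypothesis E0 : E 0 = 1.
Hypothesis EM : forall u v, (#|fsupp u| <= 4 * t)%N -> (#|fsupp v| <= 4 * t)%N ->
  E v != 0 -> E (u + v) = E u * E v.

Definition mX (f : passign V bool) : R := pexp e E (ind R f).
Definition mW (f : passign V bool) : 'rV[R]_#|{: Omega}| := lvec e E (2 * t) (ind R f).

(** An event is its own square, so its pseudo-expectation is a squared norm. Domains of size [2 * t]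
    are the reason why the moments are multiplicative up to support [4 * t]. *)
Lemma mX_ge0 f : (#|pdom f| <= 2 * t)%N -> 0 <= mX f.
Proof.
move=> ft; have D : (2 * (2 * t) <= 4 * t)%N by rewrite mulnA.
have := pexp_sqr_ge0 char2 eD e_sign e_nontriv E0 EM D (@ind_depends R F V f) ft.
by rewrite (eq_pexp _ _ (ind_sqr R f)).
Qed.

Lemma mX_extends f (S : {set V}) : pdom f \subset S ->
  \sum_(g : passign V bool | (pdom g == S) && pextends g f) mX g = mX f.
Proof.
move=> fS; rewrite -pexp_sum; apply: eq_pexp => y.
exact: ind_extends.
Qed.

Lemma mX_empty : mX (pempty V bool) = 1.
Proof.
rewrite -(pexp1 char2 eD e_sign e_nontriv E0); apply: eq_pexp => y.
rewrite /ind; by rewrite (_ : consistent _ _) //; apply/consistentP => v a; rewrite ffunE.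
Qed.

Lemma mX_local : local_distribution (2 * t) mX.
Proof.
split; first exact: mX_empty.
  (* For the upper bound, [mX f] is one term of the nonnegative sum over all patterns on [pdom f],
     which equals 1. *)
  move=> f ft; rewrite mX_ge0 //= -mX_empty -(@mX_extends (pempty V bool) (pdom f)); last first.
    by apply/subsetP => v; rewrite mem_pdom ffunE.
  rewrite (bigD1 f) /=; last first.
    by rewrite eqxx; apply/forallP => v; rewrite mem_pdom ffunE.
  by rewrite lerDl sumr_ge0 // => g /andP[/andP[/eqP gf _] _]; rewrite mX_ge0 ?gf.
by move=> f S fS _; apply: mX_extends.
Qed.

Lemma mW_dot f g : (#|pdom f| <= t)%N -> (#|pdom g| <= t)%N ->
  dotp (mW f) (mW g) = if pagree f g then mX (pjoin f g) else 0.
Proof.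
move=> ft gt; have D : (2 * (2 * t) <= 4 * t)%N by rewrite mulnA.
have le2 a : (a <= t -> a <= 2 * t)%N by move=> /leq_trans-> //; rewrite leq_pmull.
rewrite /dotp (lvec_dot char2 eD e_sign e_nontriv E0 EM D
  (@ind_depends R F V f) (@ind_depends R F V g)) ?le2 //.
case: ifP => fg.
  by apply: eq_pexp => y; rewrite ind_join fg.
by rewrite -[RHS](pexp0 e E); apply: eq_pexp => y; rewrite ind_join fg.
Qed.

Lemma mW_lasserre : lasserre_solution t mW mX.
Proof. by split; [exact: mX_local | exact: mW_dot]. Qed.

Lemma mX_single v : (forall u : Omega, (#|fsupp u| <= 1)%N -> u != 0 -> E u = 0) ->
  mX (psingle v true) = #|F|%:R^-1.
Proof.
move=> E1; rewrite -(hat0_point eD e_sign v) /mX.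
rewrite (eq_pexp _ _ (g := fun y => (y v == 0)%:R)); last first.
  move=> y; congr (_%:R); congr nat_of_bool.
  apply/consistentP/idP => [/(_ v true)|yv w a]; rewrite ffunE ?eqxx.
    by move=> ->.
  by case: eqP => // -> [<-].
apply: (pexp_singleton eD e_nontriv E0 (k := v) _ E1).
by move=> y z /(_ v); rewrite inE eqxx => ->.
Qed.

(** Any [y] consistent with a violating pattern has the wrong parity of zeros, so some dual word of
    the check detects it; this is the situation of [pexp_eq0]. *)
Lemma mX_satisfies (C : finType) (B : bigraph V C) (s : {ffun V -> bool}) (j : C)
    (H : {set Omega}) (c : Omega) :
  (#|nbhd B j| <= 2 * t)%N ->
  0 \in H -> {in H &, forall u v, u + v \in H} ->
  (forall u, u \in H -> fsupp u \subset nbhd B j) ->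
  (forall u, u \in H -> E u = e (dotf u c)) ->
  (forall y, (forall u, u \in H -> e (dotf u (y + c)) = 1) ->
     odd (\sum_(v in nbhd B j) is0 (y v)) =
     odd (\sum_(v in nbhd B j) nat_of_bool (s v))) ->
  satisfies (2 * t) mX (nearest_codeword B s j).
Proof.
move=> Nt H0 HD HN HE Hs; split.
  rewrite (_ : [set v in _]%SET = nbhd B j) //.
  by apply/setP => v; rewrite inE mem_enum.
have le4 a : (a <= 2 * t -> a <= 4 * t)%N by move=> /leq_trans-> //; rewrite leq_mul2r orbT.
move=> f; rewrite /= (_ : [set v in _]%SET = nbhd B j); last first.
  by apply/setP => v; rewrite inE mem_enum.
move=> fN /negP pf.
apply: (pexp_eq0 char2 eD e_sign e_nontriv EM (@ind_depends R F V f) _ H0 HD (c := c)).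
- by rewrite fN le4.
- move=> u uH; split; last exact: HE.
  by rewrite le4 // (leq_trans (subset_leq_card (HN u uH))).
move=> y; rewrite /ind pnatr_eq0 eqb0 negbK => fy.
have [/existsP[u /andP[]]|/existsPn none] :=
  boolP [exists u, (u \in H) && (chi e u (y + c) != 1)]; first by exists u.
case: pf; rewrite -fN (sum_pmap fy); apply/eqP; rewrite !modn2 fN Hs // => u uH.
by have := none u; rewrite uH negbK => /eqP.
Qed.

End FromMoments.

(** * Moments from expansion *)

Definition collisions (V C : finType) (N : C -> {set V}) (S : {set C}) : nat :=
  (\sum_v (#|[set j in S | v \in N j]| - 1))%N.

Section Expansion.
Variables (R : realFieldType) (F : finFieldType) (e : F -> R).
Hypothesis char2 : 2%N \in [pchar F].
Hypothesis eD : forall x y, e (x + y) = e x * e y.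
Hypothesis e_sign : forall x, e x = 1 \/ e x = -1.
Variables V C : finType.
Local Notation Omega := {ffun V -> F}.
Variables (N : C -> {set V}) (H : C -> {set Omega}) (c : C -> Omega).
Hypothesis H0 : forall j, 0 \in H j.
Hypothesis HD : forall j, {in H j &, forall u v, u + v \in H j}.
Hypothesis HN : forall j u, u \in H j -> fsupp u \subset N j.
Hypothesis Hdist : forall j u, u \in H j -> u != 0 -> (3 <= #|fsupp u|)%N.
Variable rho : nat.
Hypothesis Hexp : forall S : {set C}, (0 < #|S| <= rho)%N ->
  (collisions N S <= #|S| + #|S| %/ 4)%N.

Local Notation word := {ffun C -> Omega}.
Implicit Types w : word.

Definition legal w := [forall j, w j \in H j].
Definition total w : Omega := \sum_j w j.
Definition active w : {set C} := [set j | w j != 0]%SET.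
(** The sign that the shifts [c j] force on the character [total w] when each [w j] is a dual word
    of check [j]. *)
Definition sgn w : R := e (\sum_j dotf (w j) (c j)).

Lemma legalP w : reflect (forall j, w j \in H j) (legal w).
Proof. exact: forallP. Qed.

Lemma legalD w w' : legal w -> legal w' -> legal (w + w').
Proof. by move=> /legalP h /legalP h'; apply/legalP => j; rewrite ffunE HD. Qed.

Lemma totalD w w' : total (w + w') = total w + total w'.
Proof. by rewrite -big_split; apply: eq_bigr => j _; rewrite ffunE. Qed.

Lemma sgnD w w' : sgn (w + w') = sgn w * sgn w'.
Proof.
rewrite -eD -big_split; congr e; apply: eq_bigr => j _.
by rewrite ffunE dotfDl.
Qed.

Lemma card_activeD w w' : (#|active (w + w')%R| <= #|active w| + #|active w'|)%N.
Proof.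
have sub : active (w + w') \subset active w :|: active w'.
  apply/subsetP => j; rewrite !inE ffunE; apply: contraNT.
  by rewrite negb_or !negbK => /andP[/eqP-> /eqP->]; rewrite addr0.
by rewrite (leq_trans (subset_leq_card sub)) // cardsU leq_subr.
Qed.

Lemma active_eq0 w : #|active w| = 0%N -> w = 0.
Proof.
move=> /eqP; rewrite cards_eq0 => /eqP w0; apply/ffunP => j; rewrite ffunE.
by apply/eqP; have := in_set0 j; rewrite -w0 inE => /negbFE.
Qed.

Lemma active0 : active 0 = set0.
Proof. by apply/setP => j; rewrite !inE ffunE eqxx. Qed.

Lemma total0 : total 0 = 0.
Proof. by rewrite /total big1 // => j _; rewrite ffunE. Qed.

(* A variable in the support of exactly one word survives in the sum; at every
   other variable the incidences number at most twice the collisions. *)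
Lemma total_supp_bound w : legal w ->
  (3 * #|active w| <= #|fsupp (total w)| +
     2 * \sum_v (#|[set j in active w | w j v != 0%R]| - 1))%N.
Proof.
move=> /legalP wH; set S := active w.
have tot : (3 * #|S| <= \sum_v #|[set j in S | w j v != 0%R]|)%N.
  rewrite (eq_bigr (fun v => \sum_(j in S) ((w j v != 0%R) : nat))%N); last first.
    by move=> v _; rewrite -sum1dep_card big_mkcondr; apply: eq_bigr => j _; case: eqP.
  rewrite exchange_big mulnC -sum_nat_const; apply: leq_sum => j; rewrite inE => wj.
  apply: leq_trans (Hdist (wH j) wj) _.
  by rewrite -sum1dep_card big_mkcond; apply: leq_sum => v _; case: eqP.
apply: leq_trans tot _.
have -> : (#|fsupp (total w)| = \sum_v ((total w v != 0%R) : nat))%N.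
  by rewrite -sum1dep_card big_mkcond; apply: eq_bigr => v _; case: eqP.
rewrite big_distrr -big_split /=.
apply: leq_sum => v _; set t := [set j in S | w j v != 0]%SET.
case t1: (#|t| == 1%N); last first.
  by move: t1; case: #|t| => [|[|m]] // _; case: eqP => _ /=; lia.
suff -> : total w v != 0 by rewrite (eqP t1).
have /cards1P[j tj] := t1.
have : j \in t by rewrite tj inE.
rewrite inE => /andP[_ wjv]; rewrite sum_ffunE (bigD1 j) //= big1 ?addr0 // => l lj.
apply/eqP; apply: contraNT lj => wlv.
rewrite -in_set1 -tj !inE wlv andbT; apply: contraNneq wlv => ->.
by rewrite ffunE.
Qed.

(** With s active checks the support has at least 3s - 2(s + s/4) = s - 2(s/4) elements, the
    quotient s/4 being rounded down. This is at least s/2, and at least 2 once s is at least 2. *)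
Lemma total_expands w : legal w -> (0 < #|active w| <= rho)%N ->
  (2 <= #|fsupp (total w)|)%N /\ (#|active w| <= 2 * #|fsupp (total w)|)%N.
Proof.
move=> wH sw; have := total_supp_bound wH.
have := Hexp sw; case/andP: sw => s0 _.
have : (\sum_v (#|[set j in active w | w j v != 0%R]| - 1) <= collisions N (active w))%N.
  apply: leq_sum => v _; rewrite leq_sub2r // subset_leq_card //.
  apply/subsetP => j; rewrite !inE => /andP[-> wjv] /=.
  by apply: (subsetP (HN (legalP _ wH j))); rewrite inE.
have [s1|s1] := eqVneq #|active w| 1%N; last first.
  by move: s0 s1; set k := collisions _ _; set a := (\sum_v _)%N; lia.
(* A single check has no collision with itself, so its dual word keeps its weight of at least 3; the
   general count would only give 1. *)
have -> : (\sum_v (#|[set j in active w | w j v != 0%R]| - 1) = 0)%N.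
  rewrite big1 // => v _; apply/eqP; rewrite subn_eq0 -s1; apply: subset_leq_card.
  by apply/subsetP => j; rewrite inE => /andP[].
by rewrite s1; lia.
Qed.

Variables (r D : nat).
Hypothesis r_rho : (2 * r <= rho)%N.
Hypothesis D_r : (6 * D <= r)%N.

(** The difference is a legal word with at most [2 * r] active checks and total 0; were it nonzero,
    expansion would give it a nonempty support. *)
Lemma total_inj w w' : legal w -> legal w' ->
  (#|active w| <= r)%N -> (#|active w'| <= r)%N -> total w = total w' -> w = w'.
Proof.
move=> wH wH' wr wr' tt; apply/eqP; rewrite -subr_eq0; apply/eqP.
have -> : w - w' = w + w'.
  by apply/ffunP => j; apply/ffunP => v; rewrite !ffunE GRing.subr_pchar2.
apply: active_eq0; apply/eqP; rewrite -leqn0 leqNgt; apply/negP => s0.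
have [|+ _] := total_expands (legalD wH wH').
  by rewrite s0 (leq_trans (card_activeD _ _)) // (leq_trans _ r_rho) // mul2n -addnn leq_add.
rewrite totalD tt; have -> : total w' + total w' = 0 by exact: addff.
by rewrite (eqP (_ : fsupp 0 == set0)) ?cards0 // fsupp_eq0.
Qed.

Definition moment (u : Omega) : R :=
  if [pick w : word | [&& legal w, (#|active w| <= r)%N & total w == u]] is Some w
  then sgn w else 0.

Lemma moment_total w : legal w -> (#|active w| <= r)%N -> moment (total w) = sgn w.
Proof.
move=> wH wr; rewrite /moment; case: pickP => [w' /and3P[wH' wr' /eqP tt]|/(_ w)].
  by rewrite (total_inj wH' wH).
by rewrite wH wr eqxx.
Qed.

Lemma moment_neq0 u : moment u != 0 ->
  exists w, [/\ legal w, (#|active w| <= r)%N & total w = u].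
Proof.
rewrite /moment; case: pickP => [w /and3P[? ? /eqP ?] _|]; last by rewrite eqxx.
by exists w.
Qed.

(** Expansion bounds the number of checks behind a character by its support, which makes room for
    adding words without leaving the range [r]. *)
Lemma moment_neq0_small u : moment u != 0 ->
  exists w, [/\ legal w, (#|active w| <= r)%N, total w = u &
                (#|active w| <= 2 * #|fsupp u|)%N].
Proof.
move=> /moment_neq0[w [wH wr tw]]; exists w; split => //.
case: (posnP #|active w|) => [->//|s0].
have [|_] := total_expands wH; last by rewrite tw.
by rewrite s0 (leq_trans wr) // (leq_trans _ r_rho) // leq_pmull.
Qed.

Lemma legal0 : legal 0.
Proof. by apply/legalP => j; rewrite ffunE. Qed.

Lemma moment0 : moment 0 = 1.
Proof.
rewrite -{1}total0 moment_total ?legal0 ?active0 ?cards0 //.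
by rewrite /sgn big1 ?(signE0 eD e_sign) // => j _; rewrite ffunE dot0f.
Qed.

Lemma momentM u v : (#|fsupp u| <= D)%N -> (#|fsupp v| <= D)%N ->
  moment v != 0 -> moment (u + v) = moment u * moment v.
Proof.
move=> uD vD /moment_neq0_small[wv [vH vr tv sv]].
have [u0|u0] := eqVneq (moment u) 0; last first.
  have [wu [uH ur tu su]] := moment_neq0_small u0.
  rewrite -tu -tv -totalD !moment_total ?legalD ?sgnD //.
  by rewrite (leq_trans (card_activeD _ _)) //; lia.
(* If [moment (u + v)] were nonzero, its word plus that of [v] would total [u] with at most 4D + 2D
   active checks, hence the 6 in [D_r], and [moment u] would be a sign. *)
rewrite u0 mul0r; apply/eqP; apply/negPn/negP => /moment_neq0_small.
move=> [w [wH wr tw sw]]; have := card_fsuppD u v => suv.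
case/eqP: (oner_neq0 R).
have := signM e_sign (\sum_j dotf ((w + wv) j) (c j)).
rewrite -/(sgn (w + wv)) -moment_total ?legalD //; last first.
  by rewrite (leq_trans (card_activeD _ _)) //; lia.
by rewrite totalD tw tv (addKff char2) u0 mul0r => <-.
Qed.

Lemma moment_singleton u : (#|fsupp u| <= 1)%N -> u != 0 -> moment u = 0.
Proof.
move=> u1 un0; apply/eqP; apply/negPn/negP => /moment_neq0[w [wH wr tw]].
case: (posnP #|active w|) => [/active_eq0 w0|s0].
  by rewrite -tw w0 total0 eqxx in un0.
have [|+ _] := total_expands wH; last by rewrite tw ltnNge u1.
by rewrite s0 (leq_trans wr) // (leq_trans _ r_rho) // leq_pmull.
Qed.

Lemma moment_code j u : (0 < r)%N -> u \in H j -> moment u = e (dotf u (c j)).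
Proof.
move=> r0 uH; pose w : word := [ffun l => if l == j then u else 0].
have tw : total w = u.
  rewrite /total (bigD1 j) //= ffunE eqxx big1 ?addr0 // => l /negPf lj.
  by rewrite ffunE lj.
rewrite -{1}tw moment_total.
- congr e; rewrite (bigD1 j) //= ffunE eqxx big1 ?addr0 // => l /negPf lj.
  by rewrite ffunE lj dot0f.
- by apply/legalP => l; rewrite ffunE; case: eqP => [->|].
- apply: leq_trans r0; rewrite -(cards1 j); apply: subset_leq_card.
  by apply/subsetP => l; rewrite !inE ffunE; case: (eqVneq l j) => // _; rewrite eqxx.
Qed.

End Expansion.

(** * Expansion of random parity-check graphs *)

Section PermCounting.
Local Open Scope nat_scope.
Variable T : finType.
Implicit Types (s : {perm T}) (A Z : {set T}).

Definition perm_into A Z : {set {perm T}} := [set s : {perm T} | [forall x in A, s x \in Z]].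

Lemma perm_intoP A Z s : reflect (forall x, x \in A -> s x \in Z) (s \in perm_into A Z).
Proof. by rewrite inE; apply: forall_inP. Qed.

(** Precomposition with the transposition of [x] and [y] swaps their images and fixes those of [A],
    so all points outside [A] are equally likely to land in [Z]. *)
Lemma card_perm_into_tperm A Z x y : x \notin A -> y \notin A ->
  #|[set s in perm_into A Z | s y \in Z]| = #|perm_into (x |: A) Z|.
Proof.
move=> xA yA; pose h s := (tperm x y * s)%g.
have hK : involutive h by move=> s; rewrite /h mulgA tperm2 mul1g.
have fixA z : z \in A -> tperm x y z = z.
  by move=> zA; rewrite tpermD //; [apply: contraNneq xA => ->|apply: contraNneq yA => ->].
rewrite -[RHS](card_imset _ (can_inj hK)); congr #|pred_of_set _|.
apply/setP => s; rewrite inE; apply/andP/imsetP => [[/perm_intoP sA sy]|[s' + ->]].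
  exists (h s); last by rewrite hK.
  apply/perm_intoP => z; rewrite !inE => /orP[/eqP->|zA]; rewrite permM.
    by rewrite tpermL.
  by rewrite fixA ?sA.
move=> /perm_intoP s'A; split.
  by apply/perm_intoP => z zA; rewrite permM fixA // s'A // !inE zA orbT.
by rewrite permM tpermR s'A // !inE eqxx.
Qed.

(** Count the pairs of a permutation in [perm_into A Z] and a point outside [A] that it sends to
    [Z]: at most [#|Z| - #|A|] places of [Z] remain, and (|Z| - |A|) / (|T| - |A|) is at most |Z| /
    |T|. *)
Lemma card_perm_intoU1 A Z x : x \notin A ->
  #|T| * #|perm_into (x |: A) Z| <= #|Z| * #|perm_into A Z|.
Proof.
move=> xA; set p := #|perm_into A Z|; set p' := #|_|.
have count : (#|T| - #|A|) * p' <= p * (#|Z| - #|A|).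
  rewrite -(cardsC A) addKn -sum_nat_const -[p * _]sum_nat_const.
  rewrite (eq_bigr (fun y => \sum_(s in perm_into A Z) (s y \in Z))).
    rewrite exchange_big; apply: leq_sum => s /perm_intoP sA /=.
    rewrite leq_subRL; last first.
      rewrite -(card_imset _ (@perm_inj _ s)); apply: subset_leq_card.
      by apply/subsetP => _ /imsetP[z zA ->]; apply: sA.
    rewrite -big_mkcondr sum1dep_card -cardsUI.
    rewrite (_ : _ :&: _ = set0) ?cards0 ?addn0; last first.
      by apply/setP => z; rewrite !inE; case: (z \in A).
    rewrite -(card_imset _ (@perm_inj _ s)); apply: subset_leq_card.
    apply/subsetP => _ /imsetP[z + ->]; rewrite !inE => /orP[/sA//|].
    by case/andP.
  move=> y; rewrite inE => yA; rewrite /p' -(card_perm_into_tperm Z xA yA).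
  by rewrite -sum1dep_card big_mkcondr.
have ZT : #|Z| <= #|T| := max_card _.
have A_lt : #|A| < #|T|.
  by rewrite -(cardsC A) -addn1 leq_add2l card_gt0; apply/set0Pn; exists x; rewrite inE.
have le : #|T| * (#|Z| - #|A|) <= #|Z| * (#|T| - #|A|).
  by rewrite !mulnBr (mulnC #|Z| #|T|) leq_sub2l // leq_mul2r ZT orbT.
rewrite -(@leq_pmul2l (#|T| - #|A|)) ?subn_gt0 // (mulnCA _ #|T|).
apply: leq_trans (leq_mul (leqnn #|T|) count) _.
rewrite (mulnCA _ p) [leqRHS](_ : _ = p * (#|Z| * (#|T| - #|A|))).
  by rewrite leq_mul2l le orbT.
  by rewrite mulnC (mulnC _ p) mulnA.
Qed.

Lemma card_perm_into A Z :
  #|T| ^ #|A| * #|perm_into A Z| <= #|Z| ^ #|A| * #|{: {perm T}}|.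
Proof.
have [k] := ubnP #|A|; elim: k A => // k IH A.
have [->|[x xA]] := set_0Vmem A; first by rewrite cards0 !expn0 !mul1n max_card.
rewrite (cardsD1 x) xA add1n ltnS !expnS => Ak.
have := card_perm_intoU1 Z (_ : x \notin A :\ x).
rewrite setD1K // setD11 => /(_ isT) step; have {IH} := IH _ Ak.
set a := _ ^ _; set b := _ ^ _ => le2.
rewrite -mulnA mulnCA; apply: leq_trans (leq_mul (leqnn a) step) _.
by rewrite mulnCA -mulnA leq_mul.
Qed.

End PermCounting.

(** * Estimates for the union bound *)

Section Estimates.
Variable R : realType.

(** The left side is a single term of the binomial expansion of (1 + j/n)^n, which is at most
    e^j. *)
Lemma bin_expR n j : (0 < n)%N ->
  'C(n, j)%:R * (j%:R / n%:R) ^+ j <= expR j%:R :> R.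
Proof.
move=> n0; have [jn|/bin_small->] := leqP j n; last by rewrite mul0r expR_ge0.
have x0 : 0 <= j%:R / n%:R :> R by rewrite divr_ge0.
apply: (@le_trans _ _ ((1 + j%:R / n%:R) ^+ n)).
  rewrite exprDn (bigD1 (Ordinal (_ : j < n.+1)%N)) //= expr1n mul1r mulr_natl.
  by rewrite lerDl sumr_ge0 // => i _; rewrite expr1n mul1r mulrn_wge0 ?exprn_ge0.
have -> : expR j%:R = expR (j%:R / n%:R) ^+ n :> R.
  by rewrite -expRM_natr divfK // pnatr_eq0 -lt0n.
by apply: lerXn2r; rewrite ?nnegrE ?addr_ge0 ?expR_ge0 // expR_ge1Dx.
Qed.

(** The least number of collisions that expansion forbids to a set of [s] checks. *)
Definition excess (s : nat) : nat := (s + s %/ 4 + 1)%N.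

Definition growth (dv dc : nat) : R := expR 1 * expR dc%:R * dc%:R ^+ 3 * dv%:R.

(** Of the [dc * s] factors j/n, [j] of them pay for the choice of variables. The other [excess s]
    are at most dc s/n each: [s] of these pay for the choice of checks, as m/n is at most [dv], and
    (s/n)^(s/4 + 1) is left over. *)
Lemma term_bound (n m dv dc s j : nat) : (0 < n)%N -> (0 < s)%N -> (3 <= dc)%N ->
  (0 < dv)%N -> (m * dc = n * dv)%N -> j = (dc * s - excess s)%N ->
  'C(m, s)%:R * 'C(n, j)%:R * (j%:R / n%:R) ^+ (dc * s)
    <= growth dv dc ^+ s * (s%:R / n%:R) ^+ (s %/ 4).+1 :> R.
Proof.
move=> n0 s0 dc3 dv0 mn jE; set x : R := s%:R / n%:R.
have nR : 0 < n%:R :> R by rewrite ltr0n.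
have m0 : (0 < m)%N by case: (posnP m) mn => // -> /esym/eqP; rewrite mul0n muln_eq0 !gtn_eqF.
have mR : 0 < m%:R :> R by rewrite ltr0n.
have x0 : 0 <= x by rewrite divr_ge0.
have jx0 : 0 <= j%:R / n%:R :> R by rewrite divr_ge0.
have dcR : 1 <= dc%:R :> R by rewrite ler1n; lia.
have dvR : 1 <= dv%:R :> R by rewrite ler1n.
have ks : (excess s <= 3 * s)%N by rewrite /excess; lia.
have ka : (excess s <= dc * s)%N by apply: leq_trans ks _; rewrite leq_mul2r dc3 orbT.
have h1 : 'C(n, j)%:R * (j%:R / n%:R) ^+ j <= expR dc%:R ^+ s :> R.
  apply: le_trans (bin_expR j n0) _; rewrite -expRM_natr ler_expR -natrM ler_nat.
  by rewrite jE leq_subr.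
have h2 : (j%:R / n%:R) ^+ excess s <= (dc%:R ^+ 3) ^+ s * (x ^+ s * x ^+ (s %/ 4).+1) :> R.
  apply: (@le_trans _ _ ((dc%:R * x) ^+ excess s)).
    rewrite lerXn2r ?nnegrE // ?[0 <= dc%:R * x]mulr_ge0 // /x mulrA ler_wpM2r ?invr_ge0 //.
    by rewrite -natrM ler_nat jE leq_subr.
  have -> : x ^+ s * x ^+ (s %/ 4).+1 = x ^+ excess s.
    by rewrite -exprD addnS /excess addn1.
  rewrite exprMn.
  by rewrite ler_wpM2r ?exprn_ge0 // -exprM ler_weXn2l.
have h3 : 'C(m, s)%:R * x ^+ s <= expR 1 ^+ s * dv%:R ^+ s :> R.
  have -> : x = s%:R / m%:R * (m%:R / n%:R) by rewrite /x mulrA divfK ?gt_eqF.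
  rewrite exprMn mulrA ler_pM ?mulr_ge0 ?exprn_ge0 ?divr_ge0 //.
    by apply: le_trans (bin_expR s m0) _; rewrite -expRM_natr mul1r.
  rewrite lerXn2r ?nnegrE ?divr_ge0 // ler_pdivrMr // -natrM ler_nat mulnC -mn.
  by rewrite leq_pmulr //; lia.
rewrite -(subnK ka) -jE exprD.
set c1 := 'C(m, s)%:R; set c2 := 'C(n, j)%:R; set y := x ^+ _.+1.
set p1 := (_ / _) ^+ j; set p2 := (_ / _) ^+ excess s.
have -> : c1 * c2 * (p1 * p2) = (c2 * p1) * (c1 * p2) by ring.
have y0 : 0 <= y by rewrite exprn_ge0.
apply: le_trans (_ : expR dc%:R ^+ s * (c1 * ((dc%:R ^+ 3) ^+ s * (x ^+ s * y))) <= _).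
  apply: ler_pM => //; rewrite ?mulr_ge0 ?exprn_ge0 //.
  by rewrite ler_wpM2l.
have -> : growth dv dc ^+ s =
    expR 1 ^+ s * expR dc%:R ^+ s * (dc%:R ^+ 3) ^+ s * dv%:R ^+ s.
  by rewrite /growth !exprMn.
have -> : expR dc%:R ^+ s * (c1 * ((dc%:R ^+ 3) ^+ s * (x ^+ s * y))) =
   (expR dc%:R ^+ s * (dc%:R ^+ 3) ^+ s * y) * (c1 * x ^+ s) by ring.
have -> : expR 1 ^+ s * expR dc%:R ^+ s * (dc%:R ^+ 3) ^+ s * dv%:R ^+ s * y =
   (expR dc%:R ^+ s * (dc%:R ^+ 3) ^+ s * y) * (expR 1 ^+ s * dv%:R ^+ s) :> R by ring.
by rewrite ler_wpM2l // !mulr_ge0 // ?exprn_ge0 // ?expR_ge0 // exprn_ge0.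
Qed.

(** Each block of four factors [L] with one [x] is at most 1/16. The remaining [s %% 4], at most 3,
    factors [L] cost [L ^+ 3], and 8 makes up for the missing halves. *)
Lemma term_small (L x : R) (s : nat) : 1 <= L -> 0 <= x -> 16 * L ^+ 4 * x <= 1 ->
  L ^+ s * x ^+ (s %/ 4).+1 <= 8 * L ^+ 3 * x / 2 ^+ s.
Proof.
move=> L1 x0 small; have L0 : 0 <= L by apply: le_trans L1.
set u := (s %/ 4)%N; set v := (s %% 4)%N.
have vlt : (v <= 3)%N by rewrite -ltnS ltn_mod.
have -> : s = (4 * u + v)%N by rewrite mulnC -divn_eq.
have h : (L ^+ 4 * x) ^+ u <= (2 ^+ (4 * u))^-1.
  rewrite exprM -exprVn lerXn2r ?nnegrE ?mulr_ge0 ?exprn_ge0 // ?invr_ge0 ?exprn_ge0 //.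
  have -> : 2 ^+ 4 = 16 :> R by ring.
  by move: small; set z := L ^+ 4 * x; rewrite -mulrA -/z; lra.
have Lv : L ^+ v <= L ^+ 3 by apply: ler_weXn2l.
have tv : 2 ^+ v <= 8 :> R.
  by apply: le_trans (ler_weXn2l _ vlt) _; rewrite ?ler1n // -[8%:R]/(2 * 4)%:R; lra.
rewrite exprD exprM [x ^+ _.+1]exprS [2 ^+ (_ + _)]exprD invfM.
have -> : (L ^+ 4) ^+ u * L ^+ v * (x * x ^+ u) = x * (L ^+ 4 * x) ^+ u * L ^+ v.
  by rewrite [in RHS]exprMn; move: ((L ^+ 4) ^+ u) (x ^+ u) (L ^+ v) => a b d; ring.
set p := (2 ^+ (4 * u))^-1 in h *.
have p0 : 0 <= p by rewrite invr_ge0 exprn_ge0.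
apply: le_trans (_ : x * p * L ^+ 3 <= _).
  by rewrite ler_pM ?mulr_ge0 ?exprn_ge0 ?mulr_ge0 ?exprn_ge0 // ler_wpM2l.
have -> : 8 * L ^+ 3 * x * (p / 2 ^+ v) = x * p * L ^+ 3 * (8 / 2 ^+ v) by ring.
by rewrite ler_peMr ?mulr_ge0 ?exprn_ge0 // ler_pdivlMr ?exprn_gt0 // mul1r.
Qed.

Lemma sum_half_powers N : \sum_(0 <= s < N) s%:R / 2 ^+ s <= 2 :> R.
Proof.
suff -> : \sum_(0 <= s < N) s%:R / 2 ^+ s = 2 - 2 * N.+1%:R / 2 ^+ N :> R.
  by rewrite gerBl ?divr_ge0 ?exprn_ge0 // mulr_ge0.
elim: N => [|N IH]; first by rewrite big_geq // expr0 divr1 mulr1 subrr.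
rewrite big_nat_recr //= IH exprS -(natr1 N.+1) -(natr1 N).
have : 2 ^+ N != 0 :> R by rewrite expf_neq0 // pnatr_eq0.
by move=> ?; field.
Qed.

End Estimates.

Lemma card_div_fibers (q d M : nat) (S : {set 'I_q}) : (M = q * d)%N ->
  #|[set k : 'I_M | [exists j in S, k %/ d == j :> nat]%N]%SET| = (d * #|S|)%N.
Proof.
move=> ->; have lt (p : 'I_q * 'I_d) : (p.1 * d + p.2 < q * d)%N.
  case: p => a b /=; apply: (@leq_trans (a.+1 * d)); last by rewrite leq_mul2r ltn_ord orbT.
  by rewrite mulSn addnC ltn_add2r ltn_ord.
pose f p : 'I_(q * d) := Ordinal (lt p).
have f_div p : (f p %/ d = p.1)%N.
  have d0 : (0 < d)%N by case: p => a [b /= /(leq_ltn_trans (leq0n _))].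
  by rewrite /= divnMDl // divn_small ?addn0 // ltn_ord.
have f_inj : injective f.
  move=> p p' pp'; have p1 : p.1 = p'.1 by apply: ord_inj; rewrite -!f_div pp'.
  move: (congr1 val pp') => /=; rewrite p1 => /addnI/ord_inj.
  by case: p p' p1 {pp'} => [? ?] [? ?] /= -> ->.
have -> : [set k : 'I_(q * d) | [exists j in S, k %/ d == j :> nat]%N]%SET =
    f @: finset.setX S [set: 'I_d]%SET.
  apply/setP => k; rewrite inE; apply/exists_inP/imsetP => [[j jS /eqP kj]|[p + ->]].
    have d0 : (0 < d)%N by case: (d) k {kj} => // -[]; rewrite muln0.
    exists (j, Ordinal (ltn_pmod k d0)); first by rewrite !inE jS.
    by apply: ord_inj; rewrite /= -kj -divn_eq.
  by rewrite !inE andbT => pS; exists p.1; rewrite ?f_div.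
by rewrite card_imset // cardsX cardsT card_ord mulnC.
Qed.

Lemma extend_set (T : finType) (A : {set T}) k : (#|A| <= k <= #|T|)%N ->
  exists2 B : {set T}, A \subset B & #|B| = k.
Proof.
move=> /andP[Ak kT].
have : (0 < #|[set B : {set T} | B \subset ~: A & #|B| == (k - #|A|)%N]%SET|)%N.
  rewrite cards_draws bin_gt0; have := cardsC A; lia.
case/card_gt0P => B; rewrite inE => /andP[BA /eqP Bk].
exists (A :|: B); first exact: finset.subsetUl.
rewrite cardsU Bk; have -> : A :&: B = set0.
  by apply/setP => x; rewrite !inE; apply/negP => /andP[xA /(subsetP BA)]; rewrite inE xA.
by rewrite cards0 subn0 subnKC.
Qed.

Lemma leq_card_bigcup (I T : finType) (P : pred I) (A : I -> {set T}) :
  (#|\bigcup_(i | P i) A i| <= \sum_(i | P i) #|A i|)%N.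
Proof.
elim/big_rec2: _ => [|i k B _ Bk]; first by rewrite cards0.
by rewrite (leq_trans (leq_card_setU _ _)) // leq_add2l.
Qed.

Lemma sum_set_card (T : finType) (R : pzSemiRingType) (f : nat -> R) N :
  \sum_(S : {set T} | (0 < #|S| < N)%N) f #|S| =
  \sum_(0 <= s < N | (0 < s)%N) 'C(#|T|, s)%:R * f s.
Proof.
rewrite [RHS](eq_bigr (fun s => \sum_(S : {set T} | #|S| == s) f s)); last first.
  by move=> s _; rewrite mulr_natl -card_draws -sumr_const; apply: eq_bigl => S; rewrite inE.
rewrite big_mkord (exchange_big_dep xpredT) //= [LHS]big_mkcond.
apply: eq_bigr => S _; case: ifP => [/andP[S0 SN]|SN].
  rewrite (big_pred1 (Ordinal SN)) // => s /=.
  by rewrite eq_sym andb_idl // => /eqP->.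
rewrite big1 // => s /andP[s0 /eqP Ss].
by rewrite Ss s0 ltn_ord in SN.
Qed.

(** * Collisions among the sockets of a random permutation *)

Section Sockets.
Variables n dv dc : nat.
Hypothesis dv_gt0 : (0 < dv)%N.
Hypothesis dc_ge3 : (3 <= dc)%N.
Hypothesis dc_div : (dc %| n * dv)%N.
Local Notation M := (n * dv)%N.
Local Notation m := (num_checks n dv dc).
Implicit Types (pi : 'S_M) (S : {set 'I_m}) (v : 'I_n).

Lemma num_checksK : (m * dc = M)%N.
Proof. by rewrite /num_checks divnK. Qed.

Definition right_sockets S : {set 'I_M} :=
  [set l : 'I_M | [exists j in S, l %/ dc == j :> nat]%N]%SET.

Definition left_sockets (Y : {set 'I_n}) : {set 'I_M} :=
  [set k : 'I_M | [exists v in Y, k %/ dv == v :> nat]%N]%SET.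

Definition hits pi S v : {set 'I_M} :=
  [set k : 'I_M | (k %/ dv == v)%N && (pi k \in right_sockets S)]%SET.

(** Sockets are counted, not checks, so parallel edges from one check collide too; this is what
    controls the check degrees. *)
Definition socket_collisions pi S : nat := (\sum_v (#|hits pi S v| - 1))%N.

Lemma card_right_sockets S : #|right_sockets S| = (dc * #|S|)%N.
Proof. by rewrite card_div_fibers // num_checksK. Qed.

Lemma card_left_sockets (Y : {set 'I_n}) : #|left_sockets Y| = (dv * #|Y|)%N.
Proof. by rewrite card_div_fibers. Qed.

Lemma variable_lt (k : 'I_M) : (k %/ dv < n)%N.
Proof. by rewrite ltn_divLR. Qed.

Definition variable k : 'I_n := Ordinal (variable_lt k).

Lemma sum_hits pi S : (\sum_v #|hits pi S v| = dc * #|S|)%N.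
Proof.
rewrite -card_right_sockets -(card_imset _ (@perm_inj _ (pi^-1)%g)).
rewrite -sum1_card (partition_big variable xpredT) //=.
apply: eq_bigr => v _; rewrite -sum1_card; apply: eq_bigl => k.
rewrite inE andbC; congr andb.
by rewrite -[in RHS](permK pi k) mem_imset //; apply: perm_inj.
Qed.

(* If S is bad, the left ends of its sockets lie in the sockets of at most
   dc * #|S| - excess #|S| variables; this is a union bound over these sets. *)
Lemma bad_card S : (dc * #|S| - excess #|S| <= n)%N ->
  (#|[set pi | excess #|S| <= socket_collisions pi S]%SET| * M ^ (dc * #|S|)
    <= 'C(n, dc * #|S| - excess #|S|) *
       ((dv * (dc * #|S| - excess #|S|)) ^ (dc * #|S|) * #|{: 'S_M}|))%N.
Proof.
set j := (dc * #|S| - _)%N => jn.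
have cover : [set pi | excess #|S| <= socket_collisions pi S]%N%SET \subset
    \bigcup_(Y in [set Y : {set 'I_n} | #|Y| == j]%SET)
      (fun s => s^-1)%g @: perm_into (right_sockets S) (left_sockets Y).
  apply/subsetP => pi; rewrite inE => bad.
  pose Y0 := [set v | hits pi S v != set0]%SET.
  have Y0j : (#|Y0| + socket_collisions pi S = dc * #|S|)%N.
    rewrite -(sum_hits pi) -sum1dep_card big_mkcond -big_split /=.
    by apply: eq_bigr => v _; rewrite -card_gt0; case: #|_| => [|h] //=; rewrite subn1.
  (* The set of variables is enlarged to size exactly [j], so that one binomial coefficient counts
     the sets in the union bound. *)
  have [|Y Y0Y Yj] := @extend_set _ Y0 j; first by rewrite card_ord jn /j; lia.
  apply/bigcupP; exists Y; first by rewrite inE Yj.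
  apply/imsetP; exists (pi^-1)%g; last by rewrite invgK.
  apply/perm_intoP => l lS; rewrite inE; apply/exists_inP.
  exists (variable ((pi^-1)%g l)); last by [].
  apply: (subsetP Y0Y); rewrite inE; apply/set0Pn; exists ((pi^-1)%g l).
  by rewrite inE eqxx permKV.
have le1 := leq_trans (subset_leq_card cover) (leq_card_bigcup _ _).
apply: leq_trans (leq_mul le1 (leqnn _)) _; rewrite big_distrl /=.
rewrite -[n in 'C(n, j)]card_ord -card_draws -sum_nat_const.
apply: leq_sum => Y; rewrite inE => /eqP Yj.
rewrite card_imset; last exact: invg_inj.
have := card_perm_into (right_sockets S) (left_sockets Y).
by rewrite card_right_sockets card_left_sockets Yj card_ord mulnC.
Qed.

Definition expanding rho pi : bool :=
  [forall S : {set 'I_m}, (0 < #|S| <= rho)%N ==> (socket_collisions pi S < excess #|S|)%N].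

(** The sets of s checks contribute at most 8 L^3 s / (n 2^s) in total by [term_bound] and
    [term_small], and the sum of s / 2^s is at most 2. *)
Lemma expanding_prob (R : realType) (rho : nat) : (0 < n)%N ->
  16 * growth R dv dc ^+ 4 * rho%:R <= n%:R ->
  #|[set pi | ~~ expanding rho pi]%SET|%:R / #|{: 'S_M}|%:R
    <= 16 * growth R dv dc ^+ 3 / n%:R :> R.
Proof.
set L := growth R dv dc => n0 rhon.
have nR : 0 < n%:R :> R by rewrite ltr0n.
have dvR : 1 <= dv%:R :> R by rewrite ler1n.
have dcR : 1 <= dc%:R :> R by rewrite ler1n; lia.
have expge1 (x : R) : 0 <= x -> 1 <= expR x.
  by move=> x0; apply: le_trans (expR_ge1Dx x); rewrite lerDl.
have L_dc : dc%:R <= L.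
  rewrite /L /growth; have d3 : dc%:R <= dc%:R ^+ 3 :> R by rewrite ler_eXnr.
  have : 1 * 1 * dc%:R * 1 <= expR 1 * expR dc%:R * dc%:R ^+ 3 * dv%:R :> R.
    by rewrite !ler_pM ?mulr_ge0 ?expge1 // ler0n.
  by rewrite !mul1r mulr1.
have L1 : 1 <= L := le_trans dcR L_dc.
have L0 : 0 <= L := le_trans ler01 L1.
have PR : 0 < #|{: 'S_M}|%:R :> R by rewrite ltr0n; apply/card_gt0P; exists 1%g.
have MR : 0 < M%:R :> R by rewrite ltr0n muln_gt0 n0.
(* This keeps the number of variables in the union bound below [n], as [bad_card] requires. *)
have rho_n : (dc * rho <= n)%N.
  rewrite -(ler_nat R) natrM; apply: le_trans rhon; rewrite ler_wpM2r //.
  have : L <= L ^+ 4 by rewrite ler_eXnr.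
  have : 0 <= L ^+ 4 by rewrite exprn_ge0.
  lra.
have bound S : (0 < #|S| <= rho)%N ->
  #|[set pi | excess #|S| <= socket_collisions pi S]%N%SET|%:R / #|{: 'S_M}|%:R <=
    let j := (dc * #|S| - excess #|S|)%N in
    'C(n, j)%:R * (j%:R / n%:R) ^+ (dc * #|S|) :> R.
  move=> /andP[_ Srho] /=; set j := (_ - _)%N.
  have jn : (j <= n)%N.
    by apply: leq_trans (leq_subr _ _) _; apply: leq_trans rho_n; rewrite leq_mul2l Srho orbT.
  have := bad_card jn; rewrite -/j; set b := #|_|; set a := (dc * _)%N => le.
  rewrite ler_pdivrMr // -(@ler_pM2r _ (M%:R ^+ a)) ?exprn_gt0 //.
  have -> : j%:R / n%:R = (dv * j)%:R / M%:R :> R.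
    rewrite !natrM; field; rewrite !pnatr_eq0; lia.
  rewrite expr_div_n -!natrX.
  have -> (x y z w : R) : w != 0 -> x * (y / w) * z * w = x * (y * z) by move=> ?; field.
    by rewrite -!natrM ler_nat.
  by rewrite natrX expf_neq0 // gt_eqF.
pose term s : R := let j := (dc * s - excess s)%N in
  'C(n, j)%:R * (j%:R / n%:R) ^+ (dc * s).
have le1 : #|[set pi | ~~ expanding rho pi]%SET|%:R / #|{: 'S_M}|%:R <=
    \sum_(S : {set 'I_m} | (0 < #|S| < rho.+1)%N) term #|S|.
  rewrite ler_pdivrMr // mulr_suml.
  have cover : [set pi | ~~ expanding rho pi]%SET \subset
     \bigcup_(S : {set 'I_m} | (0 < #|S| < rho.+1)%N)
        [set pi | excess #|S| <= socket_collisions pi S]%N%SET.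
    apply/subsetP => pi; rewrite inE => /forallPn[S].
    rewrite negb_imply -leqNgt => /andP[S0 Sb].
    by apply/bigcupP; exists S; rewrite ?inE.
  have := leq_trans (subset_leq_card cover) (leq_card_bigcup _ _).
  rewrite -(ler_nat R) => /le_trans; apply; rewrite natr_sum; apply: ler_sum => S S0.
  by rewrite -ler_pdivrMr // bound.
have c0 : 0 <= 8 * L ^+ 3 / n%:R.
  by apply: divr_ge0 => //; apply: mulr_ge0 => //; apply: exprn_ge0.
apply: le_trans le1 _; rewrite sum_set_card card_ord.
apply: (@le_trans _ _ (\sum_(0 <= s < rho.+1) 8 * L ^+ 3 / n%:R * (s%:R / 2 ^+ s))).
  rewrite big_mkcond /= big_nat [leRHS]big_nat; apply: ler_sum => s /andP[_ srho].
  case: ifP => [s0|_]; last by rewrite (mulr_ge0 c0) ?divr_ge0 ?exprn_ge0 ?ler0n.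
  rewrite mulrA; apply: le_trans (term_bound R n0 s0 dc_ge3 dv_gt0 num_checksK erefl) _.
  apply: le_trans (term_small _ L1 _ _) _; first by rewrite divr_ge0.
    rewrite mulrA ler_pdivrMr // mul1r; apply: le_trans rhon.
    by rewrite ler_wpM2l ?ler_nat // mulr_ge0 ?exprn_ge0.
  by rewrite le_eqVlt; apply/orP; left; apply/eqP; rewrite -/L; ring.
rewrite -mulr_sumr; apply: le_trans (ler_wpM2l _ (sum_half_powers R _)) _.
  exact: c0.
by rewrite le_eqVlt; apply/orP; left; apply/eqP; ring.
Qed.

End Sockets.

(** * The random instance *)

Section ParityGraph.
Variables n dv dc : nat.
Hypothesis dv_gt0 : (0 < dv)%N.
Hypothesis dc_ge3 : (3 <= dc)%N.
Hypothesis dc_div : (dc %| n * dv)%N.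
Local Notation M := (n * dv)%N.
Local Notation m := (num_checks n dv dc).
Variable pi : 'S_M.
Local Notation B := (@parity_graph n dv dc pi).

Lemma check_lt (l : 'I_M) : (l %/ dc < m)%N.
Proof. by rewrite ltn_divLR ?num_checksK // (leq_trans _ dc_ge3). Qed.

Definition check (l : 'I_M) : 'I_m := Ordinal (check_lt l).

Lemma mem_right_sockets S l : (l \in right_sockets S) = (check l \in S).
Proof.
rewrite inE; apply/exists_inP/idP => [[j jS /eqP lj]|lS]; last by exists (check l).
by rewrite (_ : check l = j) //; apply: ord_inj.
Qed.

Lemma mem_nbhd (j : 'I_m) (v : 'I_n) : (v \in nbhd B j) = odd #|hits pi [set j] v|.
Proof.
rewrite inE /parity_graph; congr (odd #|pred_of_set _|); apply/setP => k.
by rewrite [LHS]inE [RHS]inE mem_right_sockets inE.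
Qed.

(** A check adjacent to a variable meets it in an odd number of sockets, hence in at least one. *)
Lemma collisions_sockets S : (collisions (nbhd B) S <= socket_collisions pi S)%N.
Proof.
apply: leq_sum => v _; rewrite leq_sub2r //.
apply: leq_trans (leq_imset_card (check \o pi) (hits pi S v)).
apply: subset_leq_card; apply/subsetP => j; rewrite inE mem_nbhd => /andP[jS].
case: (set_0Vmem (hits pi [set j] v)) => [->|[k kh] _]; first by rewrite cards0.
move: kh; rewrite inE mem_right_sockets inE => /andP[kv /eqP kj].
by apply/imsetP; exists k; rewrite // inE kv mem_right_sockets kj jS.
Qed.

(** Since [excess 1] is 2, a single check has at most one collision; a collision is then a double
    edge, which cancels modulo 2 and lowers the degree by 2. *)
Lemma card_nbhd rho (j : 'I_m) : (0 < rho)%N -> expanding dc rho pi ->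
  #|nbhd B j| = dc \/ #|nbhd B j| = (dc - 2)%N.
Proof.
move=> rho0 /forallP/(_ [set j]%SET); rewrite cards1 rho0 /= => ex.
have {}ex : (socket_collisions pi [set j]%SET <= 1)%N by [].
have tot := @sum_hits n dv dc dv_gt0 dc_div pi [set j]%SET.
have : (#|nbhd B j| + 2 * socket_collisions pi [set j]%SET = dc)%N.
  rewrite -[RHS]muln1 -{2}(cards1 j) -tot -sum1_card big_mkcond big_distrr -big_split.
  apply: eq_bigr => v _ /=; rewrite mem_nbhd.
  have : (#|hits pi [set j]%SET v| - 1 <= 1)%N.
    apply: leq_trans ex; rewrite /socket_collisions (bigD1 v) //=; exact: leq_addr.
  by case: #|_| => [|[|[|h]]].
move: ex {tot}; set a := #|_|; set b := socket_collisions _ _; lia.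
Qed.

End ParityGraph.

Section Solution.
Variables (R : realType) (i dc : nat).
Hypothesis i_gt0 : (1 <= i)%N.
Hypothesis dcE : dc = (3 * 2 ^ i + 3)%N.

Lemma lasserre_of_expansion (V C : finType) (B : bigraph V C) (rho t : nat)
    (s : {ffun V -> bool}) :
  (0 < #|V|)%N -> (dc <= 2 * t)%N -> (48 * t <= rho)%N ->
  (forall j, #|nbhd B j| = dc \/ #|nbhd B j| = (dc - 2)%N) ->
  (forall S : {set C}, (0 < #|S| <= rho)%N ->
     (collisions (nbhd B) S <= #|S| + #|S| %/ 4)%N) ->
  exists (k : nat) (W : passign V bool -> 'rV[R]_k) (X : passign V bool -> R),
    [/\ lasserre_solution t W X,
        forall j, satisfies (2 * t) X (nearest_codeword B s j),
        biased (2 * t) (3 / (dc%:R - 3)) X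
      & lasserre_value W = 3 / (dc%:R - 3)].
Proof.
move=> V0 dct trho deg exB.
have [F char2 cardF] := PrimePowerField (isT : prime 2) i_gt0.
have [e [eD e_sign e_nontriv]] := sign_character_exists R char2.
have evenF : ~~ odd #|F| by rewrite cardF oddX /= orbF -lt0n.
have code j : exists Hc : {set {ffun V -> F}} * {ffun V -> F},
  [/\ 0 \in Hc.1 /\ {in Hc.1 &, forall u v, u + v \in Hc.1},
      forall u, u \in Hc.1 -> fsupp u \subset nbhd B j,
      forall u, u \in Hc.1 -> u != 0 -> (3 <= #|fsupp u|)%N
    & forall y, (forall u, u \in Hc.1 -> e (dotf u (y + Hc.2)) = 1) ->
        odd (\sum_(v in nbhd B j) is0 (y v))%N =
        odd (\sum_(v in nbhd B j) nat_of_bool (s v))].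
  set b := odd (\sum_(v in nbhd B j) nat_of_bool (s v)).
  have lodd := line_code_odd char2 e_nontriv evenF.
  have leven := line_code_even char2 e_nontriv evenF.
  have aff := affine_code_even char2 e_nontriv evenF.
  have lb : parity_code e (unit + F)%type b by case: b.
  (* With q = [#|F|]: degree 3(q+1) is one block of parity [b] and two odd blocks that cancel;
     degree 3q+1 is one block of parity [b] and the even affine block. *)
  case: (deg j) => cN.
    have c := parity_code_sum lb (parity_code_sum lodd lodd).
    rewrite addbF in c.
    have [|H [d [? ? ? ?]]] := parity_code_transport c (N := nbhd B j).
      by rewrite cN !card_sum card_unit cardF dcE; lia.
    by exists (H, d).
  have c := parity_code_sum lb aff; rewrite addbF in c.
  have [|H [d [? ? ? ?]]] := parity_code_transport c (N := nbhd B j).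
    by rewrite cN !card_sum card_unit card_prod card_bool cardF dcE; lia.
  by exists (H, d).
have [Hc hc] := fin_all_exists code.
pose H j := (Hc j).1; pose c j := (Hc j).2.
have H0 j : 0 \in H j by case: (hc j) => -[].
have HD j : {in H j &, forall u v, u + v \in H j} by case: (hc j) => -[].
have HN j u : u \in H j -> fsupp u \subset nbhd B j by case: (hc j) => _ h _ _; apply: h.
have Hdist j u : u \in H j -> u != 0 -> (3 <= #|fsupp u|)%N.
  by case: (hc j) => _ _ h _; apply: h.
(* Multiplicativity up to support [4 * t] needs [r = 6 * (4 * t)], and uniqueness of words needs
   expansion up to [2 * r = 48 * t]. *)
pose r := (24 * t)%N.
have r_rho : (2 * r <= rho)%N by rewrite /r mulnA.
have D_r : (6 * (4 * t) <= r)%N by rewrite /r mulnA.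
pose E := moment e H c r.
have E0 : E 0 = 1 := moment0 char2 eD e_sign c H0 HD HN Hdist exB r_rho.
have EM := momentM char2 eD e_sign (c := c) HD HN Hdist exB r_rho D_r.
have E1 := moment_singleton e char2 c HN Hdist exB r_rho.
have EH := moment_code e char2 c H0 HD HN Hdist exB r_rho.
have q0 : (2 ^ i)%:R != 0 :> R by rewrite pnatr_eq0 expn_eq0.
have biasE : #|F|%:R^-1 = 3 / (dc%:R - 3) :> R.
  by rewrite cardF dcE natrD natrM addrK; field.
have Xs v : mX e E (psingle v true) = 3 / (dc%:R - 3).
  by rewrite -biasE; apply: mX_single.
have t0 : (0 < t)%N by move: dct; rewrite dcE; lia.
exists _, (mW e E t), (mX e E); split.
- exact: mW_lasserre.
- move=> j; have [_ _ _ hs] := hc j.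
  apply: (mX_satisfies (H := H j) (c := c j) char2 eD e_sign e_nontriv EM) => //.
    by case: (deg j) => ->; lia.
  + exact: HN.
  + by move=> u uH; apply: EH; rewrite // /r; lia.
- by split; [lia | exact: Xs].
- rewrite /lasserre_value (eq_bigr (fun=> 3 / (dc%:R - 3))) => [|v _].
    rewrite sumr_const -[X in _ * X]mulr_natl mulKf // pnatr_eq0; lia.
  have sv : (#|pdom (psingle v true)| <= t)%N.
    rewrite (_ : pdom _ = [set v]%SET) ?cards1 //.
    by apply/setP => w; rewrite mem_pdom ffunE inE; case: eqP.
  rewrite mW_dot // ifT; last by apply/forallP => w; rewrite eqxx implybT.
  rewrite -(Xs v); congr (mX _ _ _); apply/ffunP => w; rewrite !ffunE.
  by case: (w == v).
Qed.

End Solution.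

(** * Choice of constants and passage to the limit *)

Local Open Scope classical_set_scope.
Local Open Scope ring_scope.

Theorem theorem2 (R : realType) (dv dc i : nat) :
  (1 <= dv)%N -> (1 <= i)%N -> dc = (3 * 2 ^ i + 3)%N ->
  exists2 eta : R, 0 < eta &
    (fun n : nat =>
       @ldpc_prob R n dv dc (fun B =>
         forall s : {ffun 'I_n -> bool},
           let t := Num.truncn (eta * n%:R) in
           exists (k : nat) (W : passign 'I_n bool -> 'rV[R]_k)
                  (X : passign 'I_n bool -> R),
             [/\ lasserre_solution t W X,
                 forall j, satisfies (2 * t) X (nearest_codeword B s j),
                 biased (2 * t) (3 / (dc%:R - 3)) X
               & lasserre_value W = 3 / (dc%:R - 3)]))
      @ within [set n : nat | (dc %| n * dv)%N] \oo --> (1 : R).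
Proof.
move=> dv0 i0 dcE.
have dc3 : (3 <= dc)%N by rewrite dcE; lia.
pose L := growth R dv dc.
have L0 : 0 < L.
  by rewrite /L /growth !mulr_gt0 ?expR_gt0 ?exprn_gt0 // ltr0n // (leq_trans _ dc3).
have L4 : 0 < 16 * L ^+ 4 by rewrite mulr_gt0 // exprn_gt0.
(* Expansion is likely up to n / (16 L^4) checks, and [t] rounds use it up to [48 * t]. *)
pose eta := (48 * (16 * L ^+ 4))^-1 : R.
have eta0 : 0 < eta by rewrite invr_gt0 mulr_gt0.
exists eta => //.
set P := (X in X @ _ --> _).
have P_le1 n : P n <= 1.
  rewrite /P /ldpc_prob ler_pdivrMr ?mul1r ?ler_nat ?max_card //.
  by rewrite ltr0n; apply/card_gt0P; exists 1%g.
(* From [n1] on there are at least [dc] rounds, enough to contain the scope of each check. *)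
pose n1 := (Num.truncn (dc%:R / eta)).+1.
have P_ge n : (dc %| n * dv)%N -> (n1 <= n)%N -> 1 - 16 * L ^+ 3 / n%:R <= P n.
  move=> dcn n1n; have n0 : (0 < n)%N by apply: leq_trans n1n.
  have nR : 0 < n%:R :> R by rewrite ltr0n.
  pose rho := Num.truncn (n%:R / (16 * L ^+ 4)).
  have rho_le : 16 * L ^+ 4 * rho%:R <= n%:R.
    by rewrite mulrC -ler_pdivlMr // truncn_le // divr_ge0 // ltW.
  have := @expanding_prob n dv dc dv0 dc3 dcn R rho n0 rho_le.
  rewrite -/L; set bad := #|_|; set N := #|_| => badle.
  have NR : 0 < N%:R :> R by rewrite ltr0n; apply/card_gt0P; exists 1%g.
  apply: (@le_trans _ _ (1 - bad%:R / N%:R)); first by rewrite lerB.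
  rewrite /P /ldpc_prob -/N ler_pdivlMr // mulrBl mul1r divfK ?lt0r_neq0 //.
  rewrite lerBlDr -natrD ler_nat.
  (* Every permutation is non-expanding or has the required property. *)
  rewrite /N -cardsT; apply: leq_trans (leq_card_setU _ _).
  apply: subset_leq_card; apply/subsetP => pi _; rewrite !inE.
  case ex: (expanding dc rho pi); last by rewrite orbT.
  rewrite orbF; apply/asboolP => s /=; set t := Num.truncn _.
  have et : t%:R <= eta * n%:R by rewrite truncn_le // mulr_ge0 // ltW.
  have dct : (dc <= t)%N.
    rewrite truncn_ge_nat ?(mulr_ge0 (ltW eta0)) // -ler_pdivrMl // mulrC; apply: le_trans (_ : n1%:R <= _); last by rewrite ler_nat.
    by rewrite ltW // truncnS_gt.
  have trho : (48 * t <= rho)%N.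
    rewrite truncn_ge_nat ?(divr_ge0 _ (ltW L4)) // natrM.
    apply: le_trans (ler_wpM2l _ et) _ => //.
    have := lt0r_neq0 L4; rewrite /eta; set Q := 16 * _ => Q0.
    by suff -> : 48%:R * ((48 * Q)^-1 * n%:R) = n%:R / Q; last by field.
  apply: (@lasserre_of_expansion R i dc i0 dcE _ _ _ rho) => //.
  + by rewrite card_ord.
  + by lia.
  + by move=> j; apply: (@card_nbhd n dv dc dv0 dc3 dcn pi rho) => //; lia.
  + move=> S Srho; apply: leq_trans (@collisions_sockets n dv dc dc3 dcn pi S) _.
    have /forallP/(_ S) := ex; rewrite Srho /= /excess addn1 ltnS.
    by [].
(* The probability lies between 1 - 16 L^3 / n and 1; divisibility by [dc] comes from the restricted
   filter. *)
apply: (squeeze_cvgr (f := fun n : nat => 1 - 16 * L ^+ 3 / n%:R) (h := fun=> 1)).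
- near=> n; rewrite P_le1 andbT; apply: P_ge; near: n.
  + exact: near_withinT.
  + by apply: cvg_within; exact: nbhs_infty_ge.
- apply: cvg_within_filter.
  have inv0 : (fun n : nat => n%:R^-1 : R) @ \oo --> (0 : R).
    by rewrite -cvg_shiftS; exact: cvg_harmonic.
  have := cvgB (cvg_cst (1 : R)) (cvgM (cvg_cst (16 * L ^+ 3)) inv0).
  by rewrite mulr0 subr0; exact.
- exact: cvg_cst.
Unshelve. all: by end_near.
Qed.
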